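(* Let $I_{\mathcal{L}}$ be a lattice ideal and let $(\mathbf{F}_\bullet,\phi,\mathbf{B})$ be a based $\mathcal{A}$-homogeneous minimal free resolution of $R/I_{\mathcal{L}}$. Then $(\mathbf{F}_\bullet,\phi,\mathbf{B})$ is a strongly indispensable complex of $R/I_{\mathcal{L}}$ if and only if for every $i\ge 0$ and every $i$-Betti degree $\mathbf{b}$ of $R/I_{\mathcal{L}}$, $\mathbf{b}$ is a minimal $i$-Betti degree and $\dim_{\Bbbk}\tilde{H}_{i-1}(\Delta_{\gcd}(\mathbf{b});\Bbbk)=1$.
   Context: Setting. Let $\mathcal{L}\subset\mathbb{Z}^n$ be a lattice (subgroup) with $\mathcal{L}\cap\mathbb{N}^n=\{\mathbf{0}\}$, and let $\mathcal{A}$ be the subsemigroup (containing $0$) of $\mathbb{Z}^n/\mathcal{L}$ generated by $\mathbf{a}_i=\mathbf{e}_i+\mathcal{L}$, $1\le i\le n$, where $\mathbf e_1,\dots,\mathbf e_n$ is the canonical basis of $\mathbb{Z}^n$. $\mathcal{A}$ is partially ordered by $\mathbf{c}\ge\mathbf{d}$ iff $\mathbf{c}=\mathbf{d}+\mathbf{e}$ for some $\mathbf{e}\in\mathcal{A}$. Let $\Bbbk$ be a field and $R=\Bbbk[x_1,\dots,x_n]$, multigraded by $\mathcal{A}$ via $\deg_{\mathcal{A}}(\mathbf{x}^{\mathbf{v}})=v_1\mathbf{a}_1+\cdots+v_n\mathbf{a}_n$. The lattice ideal $I_{\mathcal{L}}$ is generated by all binomials $\mathbf{x}^{\mathbf{u}_+}-\mathbf{x}^{\mathbf{u}_-}$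 with $\mathbf{u}_+,\mathbf{u}_-\in\mathbb{N}^n$ and $\mathbf{u}_+-\mathbf{u}_-\in\mathcal{L}$. Betti degrees. $\beta_{i,\mathbf{b}}(R/I)=\dim_{\Bbbk}\operatorname{Tor}_i^R(R/I,\Bbbk)_{\mathbf{b}}$. The $i$-Betti degrees of $R/I$ are the $\mathbf{b}\in\mathcal{A}$ with $\beta_{i,\mathbf{b}}(R/I)\ne0$; the minimal $i$-Betti degrees are the minimal elements (for $\geq$) of the set of $i$-Betti degrees. gcd-complex. For $\mathbf{b}\in\mathcal{A}$, $C_{\mathbf{b}}=\{\mathbf{x}^{\mathbf{u}}:\deg_{\mathcal{A}}(\mathbf{x}^{\mathbf{u}})=\mathbf{b}\}$ (a finite set), and $\Delta_{\gcd}(\mathbf{b})$ is the simplicial complex on vertex set $C_{\mathbf{b}}$ whose faces are the empty set and all nonempty subsets $T\subset C_{\mathbf{b}}$ with $\gcd(\mathbf{x}^{\mathbf{a}}:\mathbf{x}^{\mathbf{a}}\in T)\neq1$. (For $\mathbf{b}=0$ the only face is $\emptyset$.) $\tilde H_j$ denotes reduced simplicial homology; the complex whose only face is $\emptyset$ has $\tilde{H}_{-1}=\Bbbk$ and all its other reduced homology zero. Based complexes. Complexes are $\mathcal{A}$-homogeneous: finite rank $\mathcal{A}$-graded free $R$-modules with degree-preserving maps. A minimal free resolution of $R/I$ is an exact complex $0\to G_p\xrightarrow{\theta_p}\cdots\to G_1\xrightarrow{\theta_1}G_0=R\xrightarrow{\theta_0}R/I\to0$ of this kind with $\theta_i(G_i)\subset(x_1,\dots,x_n)G_{i-1}$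 for $i\ge1$. A based complex $(\mathbf{G}_\bullet,\theta,\mathbf{C})$ is an $\mathcal{A}$-homogeneous complex with a system of bases $\mathbf{C}=(C_i)$, $C_i$ an $\mathcal{A}$-homogeneous basis of $G_i$. A complex homomorphism $\omega$ from $(\mathbf{F}_\bullet,\phi,\mathbf{B})$ to $(\mathbf{G}_\bullet,\theta,\mathbf{C})$ is a based homomorphism if for each $i$ and each $E\in B_i$ there are $H\in C_i$ and $c\in\Bbbk^*$ with $\omega(E)=cH$. Strongly indispensable complex. A based complex $(\mathbf{F}_\bullet,\phi,\mathbf{B})$ is a strongly indispensable complex of $R/I$ if for every based minimal free resolution $(\mathbf{G}_\bullet,\theta,\mathbf{C})$ of $R/I$ with $C_0=\{1\}$ there is an injective based homomorphism $\omega:(\mathbf{F}_\bullet,\phi,\mathbf{B})\to(\mathbf{G}_\bullet,\theta,\mathbf{C})$ with $\omega_0=\mathrm{id}_R$. *)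

(* Defs.v *)
From HB Require Import structures.
From mathcomp Require Import all_boot all_order all_algebra.
From mathcomp Require Import finmap.
From mathcomp.multinomials Require Import freeg mpoly.

Set Implicit Arguments.
Unset Strict Implicit.
Unset Printing Implicit Defensive.

Import Order.TTheory GRing.Theory.

Local Open Scope ring_scope.
Local Open Scope quotient_scope.

(* dim_quot Z B m : the space Z / B has dimension m, for subspaces B <= Z
   of V given as predicates. *)
Definition dim_quot (k : fieldType) (V : lmodType k) (Z B : V -> Prop)
    (m : nat) : Prop :=
  exists z : 'I_m -> V,
    (forall l, Z (z l)) /\
    (forall v, Z v ->
       exists! c : 'rV[k]_m, B (v - \sum_(l < m) c 0 l *: z l)).

Section ReducedHomology.

Variables (k : fieldType) (disp : Order.disp_t) (V : orderType disp).

Local Open Scope fset_scope.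

Definition chain := {freeg {fset V} / k}.

(* The vertices of a face are ordered by V, and the boundary of a vertex is the
   empty face, as in reduced homology. *)
Definition face_boundary (s : {fset V}) : chain :=
  \sum_(v <- s) << (-1) ^+ #|` [fset w in s | (w < v)%O]| *g s `\ v >>.

Definition boundary : chain -> chain := fglift face_boundary.

(* Chains are indexed by the number i of vertices of their faces, that is by
   the dimension i - 1 of the faces plus one. *)
Definition is_chain (Delta : {fset V} -> Prop) (i : nat) (c : chain) : Prop :=
  forall s, s \in dom c -> Delta s /\ #|` s| = i.

(* reduced_homology_dim Delta i m : dim H~_{i-1}(Delta; k) = m. *)
Definition reduced_homology_dim (Delta : {fset V} -> Prop) (i m : nat) : Prop :=
  dim_quot
    (fun c : chain => is_chain Delta i c /\ boundary c = 0)
    (fun c : chain => exists2 e, is_chain Delta i.+1 e & boundary e = c)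
    m.

End ReducedHomology.

Section Lattice.

(* A zmodClosed predicate is a subgroup with boolean membership; membership in
   a subgroup of Z^n is always decidable, the subgroup being finitely
   generated. *)
Variables (n : nat) (L : zmodClosed 'rV[int]_n).

Local Notation Q := (Quotient.quot L).

Definition pointed_lattice : Prop :=
  forall u : 'rV[int]_n, u \in L -> (forall i, 0 <= u 0 i) -> u = 0.

Definition gen (i : 'I_n) : Q := \pi_(Q) (delta_mx 0 i).

Definition adeg (v : 'X_{1..n}) : Q := \sum_(i < n) gen i *+ v i.

Definition in_A (b : Q) : Prop := exists v, b = adeg v.

Definition geA (c d : Q) : Prop := exists2 e, in_A e & c = d + e.

Definition is_gcd (T : {fset 'X_{1..n}}) (g : 'X_{1..n}) : Prop :=
  (forall v, v \in T -> (g <= v)%MM) /\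
  (forall h, (forall v, v \in T -> (h <= v)%MM) -> (h <= g)%MM).

Definition gcd_complex (b : Q) (T : {fset 'X_{1..n}}) : Prop :=
  T = fset0 \/
  [/\ T <> fset0, forall v, v \in T -> adeg v = b
    & exists2 g, is_gcd T g & g <> 0%MM].

Variable k : fieldType.
Local Notation R := {mpoly k[n]}.

Definition ideal_gen (S : R -> Prop) (p : R) : Prop :=
  exists s : seq (R * R),
    (forall q, q \in s -> S q.2) /\ p = \sum_(q <- s) q.1 * q.2.

Definition irrelevant_ideal : R -> Prop :=
  ideal_gen (fun p => exists i : 'I_n, p = 'X_i).

Definition expz (v : 'X_{1..n}) : 'rV[int]_n := \row_i (v i)%:Z.

Definition lattice_ideal : R -> Prop :=
  ideal_gen (fun p => exists u v : 'X_{1..n},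
    expz u - expz v \in L /\ p = 'X_[u] - 'X_[v]).

(* v is homogeneous of degree b in the graded free module R^r whose j-th
   standard basis vector has degree s j. *)
Definition homogeneous (r : nat) (s : 'I_r -> Q) (b : Q)
    (v : 'rV[R]_r) : Prop :=
  forall j m, m \in msupp (v 0 j) -> b = s j + adeg m.

(* Linear maps act on row vectors, by right multiplication. *)
Definition degree_preserving (r r' : nat) (s : 'I_r -> Q)
    (s' : 'I_r' -> Q) (M : 'M[R]_(r, r')) : Prop :=
  forall l, homogeneous s' (s l) (row l M).

(* The i-th module is R^(rank i), its standard basis having degrees shift i;
   diff i goes from the (i+1)-st module to the i-th one. *)
Record graded_complex := GradedComplex {
  rank : nat -> nat;
  shift : forall i, 'I_(rank i) -> Q;
  diff : forall i, 'M[R]_(rank i.+1, rank i);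
  shift_in_A : forall i j, in_A (@shift i j);
  diff_degree : forall i, degree_preserving (@shift i.+1) (@shift i) (diff i);
  diff_diff : forall i, diff i.+1 *m diff i = 0
}.

(* The rows of module_basis i are the elements of an A-homogeneous basis of the i-th
   module, which need not be the standard one. *)
Record based_complex := BasedComplex {
  complex_of :> graded_complex;
  module_basis : forall i, 'M[R]_(rank complex_of i);
  basis_homogeneous : forall i l,
    exists b, homogeneous (@shift complex_of i) b (row l (module_basis i));
  basis_unique : forall i (v : 'rV[R]_(rank complex_of i)),
    exists! c : 'rV[R]_(rank complex_of i), v = c *m module_basis i
}.

(* The module in degree 0 is R itself; p in R is then const_mx p. *)
Definition starts_at_R (G : graded_complex) : Prop :=
  rank G 0 = 1%N /\ forall j, @shift G 0 j = 0.

Definition free_resolution (I : R -> Prop) (G : graded_complex) : Prop :=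
  [/\ starts_at_R G,
      exists p, forall i, (p < i)%N -> rank G i = 0%N,
      forall p : R, I p <->
        exists w : 'rV[R]_(rank G 1), w *m diff G 0 = const_mx p
    & forall i (v : 'rV[R]_(rank G i.+1)), v *m diff G i = 0 ->
        exists w, v = w *m diff G i.+1].

Definition minimal_free_resolution (I : R -> Prop) (G : graded_complex) : Prop :=
  free_resolution I G /\
  forall i (v : 'rV[R]_(rank G i.+1)) j,
    irrelevant_ideal ((v *m diff G i) 0 j).

Definition based_homomorphism (F G : based_complex)
    (w : forall i, 'M[R]_(rank F i, rank G i)) : Prop :=
  [/\ forall i, degree_preserving (@shift F i) (@shift G i) (w i),
      forall i, diff F i *m w i = w i.+1 *m diff G i
    & forall i l, exists l' (c : k),
        c != 0 /\ row l (module_basis F i) *m w i = c%:MP *: row l' (module_basis G i)].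

Definition strongly_indispensable (I : R -> Prop) (F : based_complex) : Prop :=
  starts_at_R F /\
  forall G : based_complex,
    minimal_free_resolution I G -> module_basis G 0 = const_mx 1 ->
    exists w : forall i, 'M[R]_(rank F i, rank G i),
      [/\ based_homomorphism w,
          forall i (v : 'rV[R]_(rank F i)), v *m w i = 0 -> v = 0
        & w 0 = const_mx 1].

(* G (x)_R k with k = R / (x_1, ..., x_n): entries are replaced by their
   constant terms. *)
Definition tensor_diff (G : graded_complex) (i : nat) :
    'M[k]_(rank G i.+1, rank G i) :=
  map_mx (mcoeff 0%MM) (diff G i).

Definition tensor_degree (G : graded_complex) (i : nat) (b : Q)
    (v : 'rV[k]_(rank G i)) : Prop :=
  forall j, v 0 j != 0 -> shift j = b.

Definition tensor_cycle (G : graded_complex) (i : nat) :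
    'rV[k]_(rank G i) -> Prop :=
  match i with
  | 0 => fun _ => True
  | i'.+1 => fun v => v *m tensor_diff G i' = 0
  end.

(* tor_dim I i b m : dim_k Tor_i^R(R/I, k)_b = m, Tor being the homology of
   G (x)_R k for a graded free resolution G of R/I. *)
Definition tor_dim (I : R -> Prop) (i : nat) (b : Q) (m : nat) : Prop :=
  exists2 G : graded_complex, free_resolution I G &
    dim_quot
      (fun v : 'rV[k]_(rank G i) => tensor_degree b v /\ tensor_cycle v)
      (fun v : 'rV[k]_(rank G i) =>
         exists2 w, tensor_degree b w & w *m tensor_diff G i = v)
      m.

Definition betti_degree (I : R -> Prop) (i : nat) (b : Q) : Prop :=
  in_A b /\ exists2 m, tor_dim I i b m & m <> 0%N.

Definition minimal_betti_degree (I : R -> Prop) (i : nat) (b : Q) :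
    Prop :=
  betti_degree I i b /\
  forall c, betti_degree I i c -> geA b c -> c = b.

End Lattice.

Arguments lattice_ideal {n} L k.

(* Main.v *)
Require Import Defs.
From HB Require Import structures.
From mathcomp Require Import all_boot all_order all_algebra.
From mathcomp Require Import perm finmap.
From mathcomp.multinomials Require Import freeg mpoly.
From Stdlib Require ClassicalEpsilon Classical_Prop.

(**
The idea is to compare F with an explicit (infinite) free resolution of
R / I_L. In position i let S_i be the space of chains on the sets of i+1
monomials of equal degree. Monomials act freely on these sets by translation,
with the sets of gcd 1 as a set of representatives of the orbits, so S_i is a
free R-module, and the simplicial boundary makes S a resolution of R / I_L: in
degree b it is the augmented chain complex of the full simplex on C_b, which a
cone contracts. The faces lying in (x_1, ..., x_n) S are exactly the faces of
the gcd complex. Hence Tor_i(R / I_L, k)_b is the relative homology of the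
simplex modulo the gcd complex in dimension i, which is the reduced homology of
the gcd complex in dimension i - 1, and the right-hand side of the theorem says
that the shifts of F in each homological degree are pairwise incomparable (in
particular distinct).

If they are, the comparison map from F to another minimal resolution sends a
basis element to a scalar multiple of a basis element for degree reasons.
If two basis elements E, E' of the same homological degree have
deg E = deg E' + deg x^m, replace E by E + x^m E' in the basis of F. A based
homomorphism from F to the new based complex has to be the identity below E,
is the identity modulo (x_1, ..., x_n) on E, so sends E to E + x^m E'; then
x^m E' is a cycle, and so is E', against minimality.
*)

Set Implicit Arguments.
Unset Strict Implicit.
Unset Printing Implicit Defensive.

Import Order.TTheory GRing.Theory.

Local Open Scope ring_scope.
Local Open Scope quotient_scope.

(** * Chains on finite sets *)

Section FreegLinear.

Variables (R : nzRingType) (K : choiceType) (M : lmodType R).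

Lemma fglift_sum (f : K -> M) (D : {freeg K / R}) :
  fglift f D = \sum_(x <- dom D) coeff x D *: f x.
Proof. by rewrite -{1}[D]Freeg_dom fglift_Freeg /prelift big_map. Qed.

Lemma freegUZ (c d : R) (x : K) : c *: << d *g x >> = << c * d *g x >>.
Proof. by apply/eqP/freeg_eqP => y; rewrite coeffZ !coeffU mulrA. Qed.

Lemma fglift_scalable (f : K -> M) : scalable (fglift f).
Proof.
move=> c D.
have fgliftB := lift_is_additive f.
pose fA := GRing.isZmodMorphism.Build _ _ (fglift f) fgliftB.
pose fadd : {additive {freeg K / R} -> M} := HB.pack (fglift f) fA.
rewrite -{1}[D]freeg_sumE scaler_sumr [LHS](raddf_sum fadd) /= fglift_sum.
by rewrite scaler_sumr; apply: eq_bigr => x _; rewrite freegUZ liftU scalerA.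
Qed.

HB.instance Definition _ (f : K -> M) :=
  GRing.isZmodMorphism.Build {freeg K / R} M (fglift f) (lift_is_additive f).
HB.instance Definition _ (f : K -> M) :=
  GRing.isScalable.Build R {freeg K / R} M *:%R (fglift f) (fglift_scalable f).

Lemma freegU1Z (c : R) (x : K) : << c *g x >> = c *: << x >>.
Proof. by rewrite freegUZ mulr1. Qed.

Lemma linear_freegP (f g : {linear {freeg K / R} -> M}) :
  (forall x, f << x >> = g << x >>) -> f =1 g.
Proof.
move=> fg D; rewrite -[D]freeg_sumE !linear_sum.
by apply: eq_bigr => x _; rewrite freegU1Z !linearZ /= fg.
Qed.

End FreegLinear.

(** * The simplicial boundary and its contraction by a cone *)

Section Cone.

Variables (k : fieldType) (disp : Order.disp_t) (V : orderType disp).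

Local Open Scope fset_scope.
Local Open Scope ring_scope.

Local Notation chain := (chain k V).
Local Notation boundary := (@boundary k disp V).
Local Notation face_boundary := (@face_boundary k disp V).

Definition pos (s : {fset V}) (t : V) : nat := #|` [fset w in s | (w < t)%O]|.

(** The sign is that of moving [t] from the front of the face to its sorted place, so this is the
    usual join with the apex put first. *)
Definition cone_face (t : V) (s : {fset V}) : chain :=
  if t \in s then 0 else << (-1) ^+ pos s t *g t |` s >>.

Definition cone (t : V) : chain -> chain := fglift (cone_face t).

HB.instance Definition _ := GRing.Linear.copy boundary (fglift face_boundary).
HB.instance Definition _ t := GRing.Linear.copy (cone t) (fglift (cone_face t)).

Lemma boundaryU s : boundary << s >> = face_boundary s.
Proof. by rewrite /Defs.boundary liftU scale1r. Qed.

Lemma coneU t s : cone t << s >> = cone_face t s.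
Proof. by rewrite /cone liftU scale1r. Qed.

Lemma face_boundaryE s :
  face_boundary s = \sum_(v <- s) (-1) ^+ pos s v *: << s `\ v >>.
Proof. by apply: eq_bigr => v _; rewrite -freegU1Z. Qed.

Lemma pos_add s t v : t \notin s -> pos (t |` s) v = ((t < v)%O + pos s v)%N.
Proof.
move=> ts; rewrite /pos.
have -> : [fset w in t |` s | (w < v)%O] =
    if (t < v)%O then t |` [fset w in s | (w < v)%O]
    else [fset w in s | (w < v)%O].
  apply/fsetP => w; case: ifP => tv; rewrite !inE ?in_fsetE /=;
    by case: eqVneq => //= ->; rewrite tv ?andbF.
case: ifP => tv; last by rewrite add0n.
by rewrite cardfsU1 !inE /= (negPf ts).
Qed.

Lemma pos_rem s t v : t \in s -> pos s v = ((t < v)%O + pos (s `\ t) v)%N.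
Proof. by move=> ts; rewrite -{1}(fsetD1K ts) pos_add // in_fsetD1 eqxx. Qed.

(** The cone is a contracting homotopy. On a face containing [t], only the facet opposite to [t] has
    a nonzero cone, which gives the face back. On any other face, the boundary of the cone
    contributes the face itself and its other terms cancel against the cone of the boundary. *)
Lemma cone_boundary t (c : chain) :
  (boundary (cone t c) + cone t (boundary c)) = c.
Proof.
rewrite -[RHS]/(idfun c).
rewrite -[LHS]/(((boundary \o cone t) \+ (cone t \o boundary)) c).
apply: linear_freegP => s /=; rewrite boundaryU coneU /cone_face.
rewrite face_boundaryE linear_sum /=.
case: ifPn => ts.
  rewrite linear0 add0r (big_fsetD1 t) //= big_seq big1 ?addr0.
    rewrite linearZ /= coneU /cone_face in_fsetD1 eqxx /= fsetD1K //.
    by rewrite freegUZ (@pos_rem s t) // ltxx add0n -expr2 sqrr_sign.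
  move=> v; rewrite in_fsetD1 => /andP[vt vs].
  by rewrite linearZ /= coneU /cone_face in_fsetD1 eq_sym vt ts scaler0.
rewrite freegU1Z linearZ /= boundaryU face_boundaryE.
rewrite (big_fsetU1 _ _ ts) /= scalerDr scalerA.
rewrite pos_add // ltxx add0n -expr2 sqrr_sign scale1r fsetU1K //.
rewrite -addrA -[RHS]addr0; congr (_ + _).
rewrite scaler_sumr -big_split big_seq big1 //= => v vs.
have vt : v != t by apply: contraNneq ts => <-.
rewrite [X in _ + X]linearZ /= coneU /cone_face in_fsetD1 eq_sym (negPf vt).
rewrite (negPf ts) /=.
rewrite [in pos s t](@pos_rem s v) // pos_add // scalerA !freegUZ mulr1.
have -> : (t |` s) `\ v = t |` (s `\ v).
  apply/fsetP => w; rewrite !inE.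
  by case: (eqVneq w t) => [->|]; rewrite ?andbF //= eq_sym vt.
rewrite freegUD -!exprD.
(* Exactly one of [v < t] and [t < v] holds, so the two exponents differ by one and the terms
   cancel. *)
suff -> : (-1) ^+ ((v < t)%O + pos (s `\ v) t + ((t < v)%O + pos s v)) =
   - (-1) ^+ (pos s v + pos (s `\ v) t) :> k by rewrite addNr freegU0.
have -> : ((v < t)%O + pos (s `\ v) t + ((t < v)%O + pos s v) =
  (pos s v + pos (s `\ v) t).+1)%N.
  rewrite addnACA [((v < t)%O + _)%N](_ : _ = 1%N); last by case: ltgtP vt.
  by rewrite add1n addnC.
by rewrite exprS mulN1r.
Qed.

(* A nonempty face is a cone over its facet opposite to a vertex t, and
   [cone_boundary] gives d d (cone t c) = cone t (d d c). *)
Lemma boundary_boundary (c : chain) : boundary (boundary c) = 0.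
Proof.
suff H : forall m (s : {fset V}), #|` s| = m -> boundary (boundary << s >>) = 0.
  rewrite -[c]freeg_sumE !linear_sum big1 //= => s _.
  by rewrite freegU1Z !linearZ /= (H _ _ erefl) scaler0.
elim=> [|m IH] s cs.
  move/cardfs0_eq: cs => ->.
  by rewrite boundaryU face_boundaryE big_seq_fset0 linear0.
have [t ts] : exists t, t \in s by apply/fset0Pn; rewrite -cardfs_gt0 cs.
pose s' := s `\ t.
have cs' : #|` s'| = m by move: cs; rewrite (cardfsD1 t) ts => -[].
have ts' : t \notin s' by rewrite in_fsetD1 eqxx.
have H : boundary (boundary (cone t << s' >>)) = 0.
  have /(congr1 boundary) := cone_boundary t << s' >>.
  rewrite linearD /= => /(canRL (addrK _)) ->.
  have := cone_boundary t (boundary << s' >>).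
  by rewrite IH // linear0 addr0 => ->; rewrite subrr.
move: H; rewrite coneU /cone_face (negPf ts') fsetD1K // freegU1Z !linearZ /=.
by move/eqP; rewrite scaler_eq0 signr_eq0 /= => /eqP.
Qed.

End Cone.

(** * Graded modules and comparison of resolutions *)

(** Chain maps and homotopies are built one position at a time: [S] ties each choice to the previous
    one, and the invariant [I] guarantees that a next choice exists. *)
Lemma dependent_choice (T : nat -> Type) (I : forall i, T i -> Prop)
    (S : forall i, T i -> T i.+1 -> Prop) (t0 : T 0%N) :
  I 0%N t0 ->
  (forall i t, I i t -> exists t', I i.+1 t' /\ S i t t') ->
  exists u : forall i, T i, u 0%N = t0 /\
    forall i, I i (u i) /\ S i (u i) (u i.+1).
Proof.
move=> It0 step.
pose next i (t : {t | I i t}) := ClassicalEpsilon.constructive_indefinite_description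
  _ (step i (sval t) (svalP t)).
pose fix v i : {t | I i t} :=
  if i is j.+1 then exist _ (sval (next j (v j))) (proj1 (svalP (next j (v j))))
  else exist _ t0 It0.
exists (fun i => sval (v i)); split=> // i; split; first exact: svalP.
exact: (proj2 (svalP (next i (v i)))).
Qed.

Section Graded.

Variables (n : nat) (L : zmodClosed 'rV[int]_n) (k : fieldType).

Local Notation Q := (Quotient.quot L).
Local Notation R := {mpoly k[n]}.

(** Homogeneity is a family of predicates rather than a direct sum decomposition; this covers both
    row vectors and the infinite rank modules of chains. *)
Record gmod := Gmod {
  gcar :> lmodType R;
  ghom : Q -> gcar -> Prop;
  ghom0 : forall b, ghom b 0;
  ghomD : forall b x y, ghom b x -> ghom b y -> ghom b (x + y);
  ghomZ : forall b c m x, ghom b x -> ghom (b + adeg L m) ((c *: 'X_[m]) *: x)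
}.

Lemma adeg0 : adeg L 0%MM = 0.
Proof. by rewrite /adeg big1 // => i _; rewrite mnm0E mulr0n. Qed.

Lemma adegD m1 m2 : adeg L (m1 + m2)%MM = adeg L m1 + adeg L m2.
Proof.
by rewrite /adeg -big_split; apply: eq_bigr => i _; rewrite mnmDE mulrnDr.
Qed.

Lemma ghomZc (X : gmod) b c (x : X) : ghom b x -> ghom b (c%:MP *: x).
Proof.
move=> /(@ghomZ X b c 0%MM x).
by rewrite adeg0 addr0 mpolyX0 -mul_mpolyC mulr1.
Qed.

Lemma ghomN (X : gmod) b (x : X) : ghom b x -> ghom b (- x).
Proof. by move/(ghomZc (-1)); rewrite mpolyCN scaleNr scale1r. Qed.

Lemma ghomB (X : gmod) b (x y : X) : ghom b x -> ghom b y -> ghom b (x - y).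
Proof. by move=> hx hy; apply: ghomD => //; apply: ghomN. Qed.

Lemma ghom_sum (X : gmod) b (I : Type) (r : seq I) (P : pred I) (F : I -> X) :
  (forall i, P i -> ghom b (F i)) -> ghom b (\sum_(i <- r | P i) F i).
Proof. by move=> hF; apply: big_ind => //; [apply: ghom0 | apply: ghomD]. Qed.

Definition ghom_map (X Y : gmod) (f : X -> Y) : Prop :=
  forall b x, ghom b x -> ghom b (f x).

(** Projectivity seen by homogeneous elements only: the lifting problem is assumed solvable on them,
    and the lift is required to be correct on them. *)
Definition gproj (X : gmod) : Prop :=
  forall (Y Z : gmod) (d : {linear Z -> Y}) (g : {linear X -> Y}),
    (forall b x, ghom b x -> exists2 z, ghom b z & d z = g x) ->
    exists2 h : {linear X -> Z}, ghom_map h &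
      forall b x, ghom b x -> d (h x) = g x.

Record gcomplex := Gcomplex {
  gm : nat -> gmod;
  gd : forall i, {linear gm i.+1 -> gm i};
  gd_hom : forall i, ghom_map (gd i);
  gdd : forall i b (x : gm i.+2), ghom b x -> gd i (gd i.+1 x) = 0
}.

Definition gexact (X : gcomplex) : Prop :=
  forall i b (x : gm X i.+1), ghom b x -> gd X i x = 0 ->
    exists2 w, ghom b w & gd X i.+1 w = x.

Definition chain_map (X Y : gcomplex) (u : forall i, {linear gm X i -> gm Y i}) :
    Prop :=
  (forall i, ghom_map (u i)) /\
  forall i b (x : gm X i.+1), ghom b x -> gd Y i (u i.+1 x) = u i (gd X i x).

(** Besides homogeneity, the invariant says that the composite of the differential of [X] with the
    current map lands in the image of the differential of [Y]; this is the solvability of the next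
    lifting problem. *)
Lemma chain_map_lift (X Y : gcomplex) (u0 : {linear gm X 0 -> gm Y 0}) :
  (forall i, gproj (gm X i)) -> gexact Y -> ghom_map u0 ->
  (forall b (x : gm X 1), ghom b x ->
     exists2 y, ghom b y & gd Y 0 y = u0 (gd X 0 x)) ->
  exists2 u : forall i, {linear gm X i -> gm Y i}, u 0%N = u0 & chain_map u.
Proof.
move=> pX exY hu0 u0P.
pose I i (u : {linear gm X i -> gm Y i}) := ghom_map u /\
  forall b (x : gm X i.+1), ghom b x ->
    exists2 y, ghom b y & gd Y i y = u (gd X i x).
pose S i (u : {linear gm X i -> gm Y i}) (u' : {linear gm X i.+1 -> gm Y i.+1}) :=
  forall b (x : gm X i.+1), ghom b x -> gd Y i (u' x) = u (gd X i x).
have [//|i t [ht tP]|u [u0E uP]] := @dependent_choice _ I S u0.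
- have [h hh hP] := pX i.+1 _ _ (gd Y i) (t \o gd X i) tP.
  exists h; split; last exact: hP; split=> // b x hx.
  apply: exY; first by apply/hh/gd_hom.
  rewrite (hP b); last exact: gd_hom.
  by rewrite /= (gdd hx) linear0.
- by exists u => //; split=> i; [case: (uP i) => -[] | case: (uP i) => _].
Qed.

Lemma chain_homotopy (X Y : gcomplex) (u : forall i, {linear gm X i -> gm Y i}) :
  (forall i, gproj (gm X i)) -> gexact Y -> chain_map u ->
  (forall b (x : gm X 0), ghom b x -> u 0%N x = 0) ->
  exists2 h : forall i, {linear gm X i -> gm Y i.+1},
    forall i, ghom_map (h i) &
    forall i b (x : gm X i.+1), ghom b x ->
      u i.+1 x = gd Y i.+1 (h i.+1 x) + h i (gd X i x).
Proof.
move=> pX exY [hu uP] u00.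
pose I i (h : {linear gm X i -> gm Y i.+1}) := ghom_map h /\
  forall b (x : gm X i.+1), ghom b x ->
    exists2 y, ghom b y & gd Y i.+1 y = u i.+1 x - h (gd X i x).
pose S i (h : {linear gm X i -> gm Y i.+1})
    (h' : {linear gm X i.+1 -> gm Y i.+2}) :=
  forall b (x : gm X i.+1), ghom b x ->
    u i.+1 x = gd Y i.+1 (h' x) + h (gd X i x).
(* The homotopy can start with zero because [u] vanishes in position 0. *)
have [|i t [ht tP]|h [_ hP]] := @dependent_choice _ I S \0.
- split=> [b x _|b x hx]; first exact: ghom0.
  rewrite subr0; apply: exY; first exact: hu.
  by rewrite (uP _ b) // (u00 b) //; apply: gd_hom.
- have [h hh hP] := pX i.+1 _ _ (gd Y i.+1) (u i.+1 \- (t \o gd X i)) tP.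
  exists h; split; last by move=> b x hx; rewrite (hP b) //= subrK.
  split=> // b x hx; apply: exY.
    by apply: ghomB; [apply: hu | apply/hh/gd_hom].
  rewrite linearB /= (uP _ b) // (hP b) /=; last exact: gd_hom.
  by rewrite (gdd hx) linear0 subr0 subrr.
- by exists h => i; [case: (hP i) => -[] | case: (hP i)].
Qed.

Lemma chain_map_comp (X Y Z : gcomplex) (u : forall i, {linear gm X i -> gm Y i})
    (v : forall i, {linear gm Y i -> gm Z i}) :
  chain_map u -> chain_map v -> chain_map (fun i => v i \o u i).
Proof.
move=> [hu uP] [hv vP]; split=> [i b x hx|i b x hx] /=; first by apply/hv/hu.
by rewrite (vP _ b) ?(uP _ b) //; apply: hu.
Qed.

Lemma chain_map_homotopic_id (X : gcomplex) (u : forall i, {linear gm X i -> gm X i}) :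
  (forall i, gproj (gm X i)) -> gexact X -> chain_map u ->
  (forall b (x : gm X 0), ghom b x -> u 0%N x = x) ->
  exists2 h : forall i, {linear gm X i -> gm X i.+1},
    forall i, ghom_map (h i) &
    forall i b (x : gm X i.+1), ghom b x ->
      u i.+1 x = x + (gd X i.+1 (h i.+1 x) + h i (gd X i x)).
Proof.
move=> pX exX [hu uP] u0.
pose v i : {linear gm X i -> gm X i} := u i \- idfun.
have vP : chain_map v.
  split=> [i b x hx|i b x hx] /=; first by apply: ghomB => //; apply: hu.
  by rewrite linearB /= (uP _ b).
have [|h hh hP] := chain_homotopy pX exX vP.
  by move=> b x hx; rewrite /v /= (u0 b) // subrr.
by exists h => // i b x hx; rewrite -(hP i b) //= addrC subrK.
Qed.

(** Membership in $(x_1,\dots,x_n)X$, stated for an arbitrary module so as to apply to rows and to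
    chains alike. *)
Definition in_max (X : lmodType R) (x : X) : Prop :=
  exists y : 'I_n -> X, x = \sum_i 'X_i *: y i.

Lemma in_max0 (X : lmodType R) : in_max (0 : X).
Proof. by exists (fun=> 0); rewrite big1 // => i _; rewrite scaler0. Qed.

Lemma in_maxD (X : lmodType R) (x y : X) : in_max x -> in_max y -> in_max (x + y).
Proof.
move=> [f ->] [g ->]; exists (fun i => f i + g i).
by rewrite -big_split; apply: eq_bigr => i _; rewrite scalerDr.
Qed.

Lemma in_maxN (X : lmodType R) (x : X) : in_max x -> in_max (- x).
Proof.
move=> [f ->]; exists (fun i => - f i).
by rewrite -sumrN; apply: eq_bigr => i _; rewrite scalerN.
Qed.

Lemma in_maxB (X : lmodType R) (x y : X) : in_max x -> in_max y -> in_max (x - y).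
Proof. by move=> hx hy; apply/in_maxD/in_maxN. Qed.

Lemma in_max_map (X Y : lmodType R) (f : {linear X -> Y}) (x : X) :
  in_max x -> in_max (f x).
Proof.
move=> [y ->]; exists (fun i => f (y i)).
by rewrite linear_sum; apply: eq_bigr => i _; rewrite linearZ.
Qed.

End Graded.

(** * Graded free modules of row vectors and reduction modulo the variables *)

Section GradedRows.

Variables (n : nat) (L : zmodClosed 'rV[int]_n) (k : fieldType).

Local Notation Q := (Quotient.quot L).
Local Notation R := {mpoly k[n]}.

Lemma adegE m : adeg L m = \pi_(Q) (expz m).
Proof.
rewrite /adeg /gen [expz m]row_sum_delta raddf_sum.
apply: eq_bigr => i _; rewrite mxE -natz scaler_nat; exact/esym/raddfMn.
Qed.

Lemma adeg_eq m m' : adeg L m = adeg L m' <-> expz m - expz m' \in L.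
Proof. by rewrite !adegE Quotient.idealrBE; split=> /eqP. Qed.

(** The exponent vector of [m] is a nonnegative element of [L], so pointedness kills it. *)
Lemma adeg_eq0 (hL : pointed_lattice L) m : adeg L m = 0 -> m = 0%MM.
Proof.
rewrite -(adeg0 L) => /adeg_eq; set u := _ - _ => /hL u0.
have {}u0 : u = 0.
  by apply: u0 => i; rewrite !mxE mnm0E subr0.
apply/mnmP => i; rewrite mnm0E.
by move/rowP/(_ i): u0; rewrite !mxE mnm0E subr0 => -[].
Qed.

Lemma geAP (c d : Q) : geA c d <-> exists m, c = d + adeg L m.
Proof.
split=> [[e [m ->] ->]|[m ->]]; first by exists m.
by exists (adeg L m) => //; exists m.
Qed.

Lemma geA_refl (c : Q) : geA c c.
Proof. by apply/geAP; exists 0%MM; rewrite adeg0 addr0. Qed.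

Lemma ghomZp (X : gmod L k) b b' (p : R) (x : X) :
  ghom b x -> (forall m, m \in msupp p -> b' = b + adeg L m) ->
  ghom b' (p *: x).
Proof.
move=> hx hp; rewrite [p]mpolyE scaler_suml big_seq; apply: ghom_sum => m mp.
by rewrite (hp m mp); apply: ghomZ.
Qed.

Lemma in_maxX (X : lmodType R) (m : 'X_{1..n}) (x : X) :
  m != 0%MM -> in_max ('X_[m] *: x).
Proof.
rewrite -mdeg_eq0 => m0.
have [i mi] : exists i, (0 < m i)%N.
  apply/existsP; apply: contraNT m0 => /existsPn m0.
  by rewrite mdegE big1 // => i _; apply/eqP; rewrite -leqn0 leqNgt m0.
exists (fun j => if j == i then 'X_[m - U_(i)] *: x else 0).
rewrite (bigD1 i) //= eqxx big1 => [|j /negPf ->]; last by rewrite scaler0.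
by rewrite addr0 scalerA -mpolyXD addmC submK // lep1mP -lt0n.
Qed.

Lemma in_maxZr (X : lmodType R) (p : R) (x : X) : in_max x -> in_max (p *: x).
Proof. by move=> hx; apply: (in_max_map [the {linear X -> X} of *:%R p] hx). Qed.

Lemma in_max_sum (X : lmodType R) (I : Type) (r : seq I) (P : pred I) (F : I -> X) :
  (forall i, P i -> in_max (F i)) -> in_max (\sum_(i <- r | P i) F i).
Proof. by move=> hF; apply: big_ind => //; [apply: in_max0 | apply: in_maxD]. Qed.

Lemma in_maxZ (X : lmodType R) (p : R) (x : X) : p@_0%MM = 0 -> in_max (p *: x).
Proof.
move=> p0; rewrite [p]mpolyE scaler_suml big_seq; apply: in_max_sum => m mp.
rewrite -mul_mpolyC -scalerA; apply/in_maxZr/in_maxX.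
by apply: contraTneq mp => ->; rewrite mcoeff_msupp p0 eqxx.
Qed.

Lemma mcoeff0M (p q : R) : (p * q)@_0%MM = p@_0%MM * q@_0%MM.
Proof. exact: (rmorphM (mcoeff 0%MM)). Qed.

(** [red] is reduction modulo the variables and [cst] its section; they pass between a resolution
    and its tensor product with [k]. *)
Definition red r c (v : 'M[R]_(r, c)) : 'M[k]_(r, c) := map_mx (mcoeff 0%MM) v.
Definition cst r c (v : 'M[k]_(r, c)) : 'M[R]_(r, c) := map_mx (@mpolyC n k) v.

Lemma cstK r c (v : 'M[k]_(r, c)) : red (cst v) = v.
Proof. by apply/matrixP => i j; rewrite !mxE mcoeffC eqxx mulr1. Qed.

Lemma redD r c (v w : 'M[R]_(r, c)) : red (v + w) = red v + red w.
Proof. exact: map_mxD. Qed.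

Lemma redB r c (v w : 'M[R]_(r, c)) : red (v - w) = red v - red w.
Proof. exact: map_mxB. Qed.

Lemma redM r c e (v : 'M[R]_(r, c)) (w : 'M[R]_(c, e)) :
  red (v *m w) = red v *m red w.
Proof.
apply/matrixP => i j; rewrite !mxE raddf_sum /=.
by apply: eq_bigr => l _; rewrite !mxE mcoeff0M.
Qed.

Lemma red_in_max r (v : 'rV[R]_r) : in_max v <-> red v = 0.
Proof.
split=> [[y ->]|v0].
  apply/rowP => j; rewrite !mxE summxE raddf_sum /= big1 //= => i _.
  rewrite mxE mcoeff0M mcoeffX.
  by rewrite -mdeg_eq0 mdeg1 mul0r.
rewrite [v]row_sum_delta; apply: in_max_sum => j _; apply: in_maxZ.
by move/rowP/(_ j): v0; rewrite !mxE.
Qed.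

Lemma irrelevant_mcoeff0 (p : R) : irrelevant_ideal p -> p@_0%MM = 0.
Proof.
move=> [s [hs ->]]; rewrite raddf_sum /= big_seq big1 //= => q /hs [i ->].
rewrite mcoeff0M mcoeffX.
by rewrite -mdeg_eq0 mdeg1 mulr0.
Qed.

Definition hpart (b : Q) (p : R) : R :=
  \sum_(m <- msupp p | adeg L m == b) p@_m *: 'X_[m].

Lemma mcoeff_hpart b p m : (hpart b p)@_m = if adeg L m == b then p@_m else 0.
Proof.
rewrite /hpart raddf_sum /=.
under eq_bigr => i _ do rewrite mcoeffZ mcoeffX.
have [mp|mp] := boolP (m \in msupp p); last first.
  rewrite (memN_msupp_eq0 mp) if_same big_seq_cond big1 // => i /andP[ip _].
  by rewrite (negPf (memPn mp _ ip)) mulr0.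
rewrite big_mkcond (bigD1_seq m) //= ?eqxx ?msupp_uniq // big1 ?addr0 ?mulr1 //.
by move=> i /negPf im; rewrite im mulr0 if_same.
Qed.

Lemma hpart_is_zmod_morphism b : zmod_morphism (hpart b).
Proof.
move=> p q; apply/mpolyP => m; rewrite mcoeffB !mcoeff_hpart mcoeffB.
by case: ifP => // _; rewrite subrr.
Qed.

HB.instance Definition _ b :=
  GRing.isZmodMorphism.Build R R (hpart b) (hpart_is_zmod_morphism b).

Lemma hpart_id b p : (forall m, m \in msupp p -> adeg L m = b) -> hpart b p = p.
Proof.
move=> hp; apply/mpolyP => m; rewrite mcoeff_hpart; case: eqP => // mb.
by rewrite memN_msupp_eq0 //; apply/negP => /hp.
Qed.

Lemma hpart_supp b p m : m \in msupp (hpart b p) -> adeg L m = b.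
Proof. by rewrite mcoeff_msupp mcoeff_hpart; case: ifP => [/eqP|_ /eqP]. Qed.

(** Split [p] into its part of degree [b] and the rest. By cancellation in the group [Q], the rest
    times [q] has no monomial of degree [b + c]. *)
Lemma hpartM b c p q : (forall m, m \in msupp q -> adeg L m = c) ->
  hpart (b + c) (p * q) = hpart b p * q.
Proof.
move=> hq; rewrite -{1}(subrK (hpart b p) p) mulrDl raddfD /=.
rewrite [X in _ + X]hpart_id; last first.
  move=> m /msuppM_le/allpairsP[[m1 m2] /= [/hpart_supp h1 /hq h2 ->]].
  by rewrite adegD h1 h2.
rewrite [X in X + _](_ : _ = 0) ?add0r //.
apply/mpolyP => m; rewrite mcoeff_hpart mcoeff0; case: eqP => // mb.
rewrite memN_msupp_eq0 //; apply/negP.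
move=> /msuppM_le/allpairsP[[m1 m2] /= [h1 /hq h2 m12]].
move: h1; rewrite mcoeff_msupp mcoeffB mcoeff_hpart.
have -> : adeg L m1 = b.
  by move: mb; rewrite m12 adegD h2 => /addIr.
by rewrite eqxx subrr eqxx.
Qed.

Lemma homogeneous0 r (s : 'I_r -> Q) b : homogeneous s b (0 : 'rV[R]_r).
Proof. by move=> j m; rewrite mxE msupp0. Qed.

Lemma homogeneousD r (s : 'I_r -> Q) b (v w : 'rV[R]_r) :
  homogeneous s b v -> homogeneous s b w -> homogeneous s b (v + w).
Proof.
move=> hv hw j m; rewrite mxE => /msuppD_le; rewrite mem_cat.
by case/orP => [/hv|/hw].
Qed.

Lemma homogeneousZ r (s : 'I_r -> Q) b c m (v : 'rV[R]_r) :
  homogeneous s b v -> homogeneous s (b + adeg L m) ((c *: 'X_[m]) *: v).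
Proof.
move=> hv j m'; rewrite mxE => /msuppM_le/allpairsP[[m1 m2] /= [h1 h2 ->]].
move/msuppZ_le: h1; rewrite msuppX inE => /eqP ->.
by rewrite (hv _ _ h2) -addrA -adegD addmC.
Qed.

Definition row_gmod r (s : 'I_r -> Q) : gmod L k :=
  Gmod (homogeneous0 s) (@homogeneousD r s) (@homogeneousZ r s).

Lemma homogeneous_delta r (s : 'I_r -> Q) j :
  homogeneous s (s j) (delta_mx 0 j : 'rV[R]_r).
Proof.
move=> i m; rewrite mxE eqxx /= eq_sym; case: eqVneq => [->|_].
  by rewrite msupp1 inE => /eqP ->; rewrite adeg0 addr0.
by rewrite msupp0.
Qed.

Lemma homogeneousM r r' (s : 'I_r -> Q) (s' : 'I_r' -> Q) (M : 'M[R]_(r, r')) b v :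
  degree_preserving s s' M -> homogeneous s b v -> homogeneous s' b (v *m M).
Proof.
move=> hM hv; rewrite mulmx_sum_row; apply: (@ghom_sum _ _ _ (row_gmod s')) => l _.
by apply: (@ghomZp (row_gmod s') (s l)) => [|m]; [apply: hM | apply: hv].
Qed.

Lemma degree_preservingM r r' r'' (s : 'I_r -> Q) (s' : 'I_r' -> Q) (s'' : 'I_r'' -> Q)
    (M : 'M[R]_(r, r')) (N : 'M[R]_(r', r'')) :
  degree_preserving s s' M -> degree_preserving s' s'' N ->
  degree_preserving s s'' (M *m N).
Proof. by move=> hM hN l; rewrite row_mul; apply: homogeneousM. Qed.

Lemma row_proj r (s : 'I_r -> Q) : gproj (row_gmod s).
Proof.
move=> Y Z d g hg.
have /fin_all_exists2 [z hz dz] j := hg (s j) _ (@homogeneous_delta _ s j).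
pose h (v : 'rV[R]_r) : Z := \sum_j v 0 j *: z j.
have hlin : linear h.
  move=> a v w; rewrite /h scaler_sumr -big_split; apply: eq_bigr => j _ /=.
  by rewrite !mxE scalerDl scalerA.
pose hL := GRing.isLinear.Build R 'rV[R]_r Z *:%R h hlin.
exists (HB.pack h hL : {linear 'rV[R]_r -> Z}) => b v hv /=.
  by apply: ghom_sum => j _; apply: ghomZp (hz j) _ => m; apply: hv.
rewrite /h linear_sum [in RHS](row_sum_delta v) linear_sum.
by apply: eq_bigr => j _; rewrite !linearZ /= dz.
Qed.

Definition hrow r (s : 'I_r -> Q) (b : Q) (v : 'rV[R]_r) : 'rV[R]_r :=
  \row_j hpart (b - s j) (v 0 j).

Lemma hrow_id r (s : 'I_r -> Q) b v : homogeneous s b v -> hrow s b v = v.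
Proof.
move=> hv; apply/rowP => j; rewrite mxE hpart_id // => m /hv ->.
by rewrite addrC addKr.
Qed.

Lemma hrow_hom r (s : 'I_r -> Q) b v : homogeneous s b (hrow s b v).
Proof. by move=> j m; rewrite mxE => /hpart_supp ->; rewrite addrC subrK. Qed.

(** This lets a preimage of a homogeneous vector be replaced by its component of the right
    degree. *)
Lemma hrowM r r' (s : 'I_r -> Q) (s' : 'I_r' -> Q) (M : 'M[R]_(r, r')) b v :
  degree_preserving s s' M -> hrow s' b (v *m M) = hrow s b v *m M.
Proof.
move=> hM; apply/rowP => j; rewrite !mxE raddf_sum /=; apply: eq_bigr => l _.
rewrite mxE -(subrKA (s l)) hpartM // => m hm.
by apply/eqP; rewrite -subr_eq opprK addrC; apply/eqP/esym/hM; rewrite mxE.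
Qed.

End GradedRows.

(** * The resolution by simplices *)

Section ChainModule.

Variables (n : nat) (k : fieldType).

Local Notation R := {mpoly k[n]}.
Local Notation X := 'X_{1..n}.
Local Notation kchain := {freeg {fset X} / k}.

Local Open Scope fset_scope.
Local Open Scope ring_scope.

Local Notation bd := (@boundary k _ X).

Definition trans (m : X) (T : {fset X}) : {fset X} := [fset (m + v)%MM | v in T].

Lemma transP m T v : reflect (exists2 w, w \in T & v = (m + w)%MM) (v \in trans m T).
Proof. exact: imfsetP. Qed.

Lemma mem_trans m T v : ((m + v)%MM \in trans m T) = (v \in T).
Proof. by rewrite mem_imfset //; apply: addmI. Qed.

Lemma trans0 T : trans 0%MM T = T.
Proof.
apply/fsetP => v; apply/transP/idP => [[w wT ->]|vT]; first by rewrite add0m.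
by exists v; rewrite ?add0m.
Qed.

Lemma transD m1 m2 T : trans m1 (trans m2 T) = trans (m1 + m2)%MM T.
Proof.
apply/fsetP => v; apply/transP/transP => [[w /transP[u uT ->] ->]|[w wT ->]].
  by exists u; rewrite ?addmA.
by exists (m2 + w)%MM; rewrite ?mem_trans ?addmA.
Qed.

Lemma card_trans m T : #|` trans m T| = #|` T|.
Proof. by rewrite card_imfset //=; apply: addmI. Qed.

Lemma trans_rem m T v : trans m (T `\ v) = trans m T `\ (m + v)%MM.
Proof.
apply/fsetP => w; rewrite in_fsetD1; apply/transP/andP => [[u]|[wv /transP[u uT wE]]].
  rewrite in_fsetD1 => /andP[uv uT] ->; rewrite mem_trans uT; split=> //.
  by apply: contra_neq uv; apply: addmI.
exists u => //; rewrite in_fsetD1 uT andbT.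
by apply: contra_neq wv => <-.
Qed.

(** The monomial order is compatible with multiplication, so translation preserves the signs of the
    boundary. *)
Lemma pos_trans m T v : pos (trans m T) (m + v)%MM = pos T v.
Proof.
rewrite /pos -(card_trans m [fset w in T | (w < v)%O]); congr #|` _|.
apply/fsetP => w; rewrite !inE /=; apply/andP/transP => [[/transP[u uT ->]]|[u]].
  by rewrite ltmc_add2r => uv; exists u; rewrite // !inE uT uv.
by rewrite !inE => /andP[uT uv] ->; rewrite mem_trans uT ltmc_add2r.
Qed.

Definition shift_chain (m : X) : kchain -> kchain :=
  fglift (fun T => << trans m T >> : kchain).

HB.instance Definition _ m :=
  GRing.Linear.copy (shift_chain m) (fglift (fun T => << trans m T >> : kchain)).

Lemma shift_chainU m T : shift_chain m << T >> = << trans m T >>.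
Proof. by rewrite /shift_chain liftU scale1r. Qed.

Lemma shift_chain0 : shift_chain 0%MM =1 id.
Proof.
apply: (linear_freegP (f := shift_chain 0%MM) (g := idfun)) => T /=.
by rewrite shift_chainU trans0.
Qed.

Lemma shift_chainD m1 m2 c :
  shift_chain m1 (shift_chain m2 c) = shift_chain (m1 + m2)%MM c.
Proof.
apply: (linear_freegP (f := shift_chain m1 \o shift_chain m2)) => T /=.
by rewrite !shift_chainU transD.
Qed.

Lemma boundary_shift_chain m (c : kchain) :
  boundary (shift_chain m c) = shift_chain m (boundary c).
Proof.
pose f : {linear kchain -> kchain} := bd \o shift_chain m.
pose g : {linear kchain -> kchain} := shift_chain m \o bd.
apply: (linear_freegP (f := f) (g := g)) => T /=.
rewrite shift_chainU !boundaryU !face_boundaryE linear_sum.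
rewrite big_imfset /=; last by move=> ? ? _ _; apply: addmI.
by apply: eq_bigr => v _; rewrite linearZ /= shift_chainU pos_trans trans_rem.
Qed.

(* The same group as [kchain], as a module over the polynomial ring, monomials
   acting by translation of the faces. *)
Definition schain : Type := kchain.

HB.instance Definition _ := GRing.Zmodule.on schain.

Definition schain_scale (p : R) (c : schain) : schain :=
  fglift (fun m => shift_chain m c) (mpoly_val p).

Lemma schain_scaleDl c : {morph schain_scale^~ c : p q / p + q}.
Proof. by move=> p q; apply: (raddfD (fglift _)). Qed.

Lemma schain_scaleDr : right_distributive schain_scale +%R.
Proof.
move=> p c d; rewrite /schain_scale !fglift_sum -big_split.
by apply: eq_bigr => m _; rewrite raddfD /= scalerDr.
Qed.

Lemma schain_scaleX a m (c : schain) :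
  schain_scale (a *: 'X_[m]) c = a *: shift_chain m c :> kchain.
Proof.
pose g : {linear {freeg X / k} -> kchain} := fglift (fun m => shift_chain m c).
rewrite -[LHS]/(g (a *: mpoly_val 'X_[m])) linearZ; congr (_ *: _).
have -> : mpoly_val 'X_[m] = << m >> :> {freeg X / k} by rewrite unlock.
by rewrite /g /= liftU scale1r.
Qed.

Lemma schain_scaleE p (c : schain) :
  schain_scale p c = \sum_(m <- msupp p) p@_m *: shift_chain m c :> kchain.
Proof. by rewrite /schain_scale fglift_sum msuppE. Qed.

Lemma schain_scaleA p q c : schain_scale p (schain_scale q c) = schain_scale (p * q) c.
Proof.
have sum1 I (r : seq I) F d : schain_scale (\sum_(i <- r) F i) d =
    \sum_(i <- r) schain_scale (F i) d.
  apply: (big_morph (schain_scale^~ d) (schain_scaleDl d)).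
  by rewrite schain_scaleE msupp0 big_nil.
rewrite [in RHS](mpolyE p) mulr_suml sum1 [LHS]schain_scaleE.
apply: eq_bigr => m1 _; rewrite schain_scaleE linear_sum /= scaler_sumr.
rewrite [in RHS](mpolyE q) mulr_sumr sum1; apply: eq_bigr => m2 _.
rewrite -scalerAl -scalerAr -mpolyXD scalerA schain_scaleX.
by rewrite linearZ /= shift_chainD scalerA.
Qed.

Lemma schain_scale1 : left_id 1 schain_scale.
Proof.
move=> c; rewrite -(scale1r 1) -mpolyX0 schain_scaleX scale1r.
exact: shift_chain0.
Qed.

HB.instance Definition _ := GRing.Zmodule_isLmodule.Build R schain
  schain_scaleA schain_scale1 schain_scaleDr schain_scaleDl.

Lemma schain_scaleXE a m (c : schain) :
  (a *: 'X_[m]) *: c = a *: (shift_chain m c : kchain).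
Proof. exact: schain_scaleX. Qed.

Lemma schain_scaleX1 m (c : schain) : 'X_[m] *: c = shift_chain m c.
Proof. by rewrite -[X in X *: _]scale1r schain_scaleXE scale1r. Qed.

Lemma schain_scaleC a (c : schain) : a%:MP *: c = a *: (c : kchain).
Proof.
by rewrite -[a%:MP]mulr1 mul_mpolyC -mpolyX0 schain_scaleXE shift_chain0.
Qed.

(* Restriction of scalars to k, since [fglift] asks for a module over the
   coefficients of the chains. *)
Definition restrict (Y : lmodType R) : Type := Y.

HB.instance Definition _ (Y : lmodType R) := GRing.Zmodule.on (restrict Y).

Section Restrict.
Variable Y : lmodType R.
Implicit Type y : restrict Y.

Definition restrict_scale (a : k) (y : restrict Y) : restrict Y := a%:MP *: (y : Y).

Lemma restrict_scaleA a b y :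
  restrict_scale a (restrict_scale b y) = restrict_scale (a * b) y.
Proof. by rewrite /restrict_scale scalerA mpolyCM. Qed.

Lemma restrict_scale1 : left_id 1 restrict_scale.
Proof. by move=> y; rewrite /restrict_scale mpolyC1 scale1r. Qed.

Lemma restrict_scaleDr : right_distributive restrict_scale +%R.
Proof. by move=> a y z; apply: scalerDr. Qed.

Lemma restrict_scaleDl y : {morph restrict_scale^~ y : a b / a + b}.
Proof. by move=> a b; rewrite /restrict_scale mpolyCD scalerDl. Qed.

HB.instance Definition _ := GRing.Zmodule_isLmodule.Build k (restrict Y)
  restrict_scaleA restrict_scale1 restrict_scaleDr restrict_scaleDl.

(** Faces form a [k]-basis of the chains, and compatibility with translations turns the [k]-linear
    extension of [f] into an [R]-linear one. *)
Lemma schain_lift (f : {fset X} -> Y) :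
  (forall m T, f (trans m T) = 'X_[m] *: f T) ->
  exists g : {linear schain -> Y}, forall T : {fset X}, g << T >> = f T.
Proof.
move=> fT.
have [g0 g0U] : exists g0 : {linear kchain -> restrict Y},
    forall T : {fset X}, g0 << T >> = f T.
  by exists (fglift (f : _ -> restrict Y)) => T /=; rewrite liftU scale1r.
have g0X m c : g0 (shift_chain m c) = 'X_[m] *: (g0 c : Y).
  rewrite -[c]freeg_sumE !linear_sum /=; apply: eq_bigr => T _.
  rewrite freegU1Z !linearZ /= shift_chainU !g0U fT.
  by rewrite -[LHS]/(_%:MP *: _) -[in RHS]/(_%:MP *: _) !scalerA mulrC.
have g0lin : linear (g0 : schain -> Y).
  move=> p c d; rewrite linearD; congr (_ + _).
  rewrite [p *: c]schain_scaleE linear_sum [in RHS](mpolyE p) scaler_suml.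
  apply: eq_bigr => m _; rewrite linearZ /= g0X -mul_mpolyC -scalerA.
  by [].
pose gL := GRing.isLinear.Build R schain Y *:%R g0 g0lin.
by exists (HB.pack (g0 : schain -> Y) gL : {linear schain -> Y}) => T; apply: g0U.
Qed.

End Restrict.

Lemma boundary_linear : linear (bd : schain -> schain).
Proof.
move=> p c d; rewrite linearD; congr (_ + _).
rewrite [p *: c]schain_scaleE [RHS]schain_scaleE linear_sum.
by apply: eq_bigr => m _; rewrite linearZ /= boundary_shift_chain.
Qed.

Definition sboundary (c : schain) : schain := boundary c.

HB.instance Definition _ :=
  GRing.isLinear.Build R schain schain *:%R sboundary boundary_linear.

End ChainModule.

(** * Exactness and projectivity of the simplex complex *)

Section SimplexComplex.

Variables (n : nat) (L : zmodClosed 'rV[int]_n) (k : fieldType).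

Local Notation Q := (Quotient.quot L).
Local Notation X := 'X_{1..n}.
Local Notation kchain := {freeg {fset X} / k}.
Local Notation schain := (schain n k).
Local Notation bd := (@boundary k _ X).

Local Open Scope fset_scope.
Local Open Scope ring_scope.

Definition simplex (i : nat) (b : Q) (T : {fset X}) : Prop :=
  #|` T| = i /\ forall v, v \in T -> adeg L v = b.

Definition simplex_chain (i : nat) (b : Q) (c : kchain) : Prop :=
  forall T, T \in dom c -> simplex i b T.

Lemma simplex_chain0 i b : simplex_chain i b 0.
Proof. by move=> T; rewrite dom0. Qed.

Lemma simplex_chainD i b c d :
  simplex_chain i b c -> simplex_chain i b d -> simplex_chain i b (c + d).
Proof.
by move=> hc hd T /domD_subset; rewrite mem_cat => /orP[/hc|/hd].
Qed.

Lemma simplex_chainZ i b a c : simplex_chain i b c -> simplex_chain i b (a *: c).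
Proof. by move=> hc T /domZ_subset /hc. Qed.

Lemma simplex_chain_sum i b (I : eqType) (r : seq I) (F : I -> kchain) :
  (forall j, j \in r -> simplex_chain i b (F j)) ->
  simplex_chain i b (\sum_(j <- r) F j).
Proof.
move=> hF; rewrite big_seq.
apply: big_ind => //; [exact: simplex_chain0 | exact: simplex_chainD].
Qed.

Lemma simplex_chainU i b T : simplex i b T -> simplex_chain i b << T >>.
Proof. by move=> hT S; rewrite domU1 inE => /eqP ->. Qed.

Lemma simplex_chain_map i i' b b' (f : {linear kchain -> kchain}) c :
  (forall T, simplex i b T -> simplex_chain i' b' (f << T >>)) ->
  simplex_chain i b c -> simplex_chain i' b' (f c).
Proof.
move=> hf hc; rewrite -[c]freeg_sumE linear_sum.
apply: simplex_chain_sum => T Tc; rewrite freegU1Z linearZ /=.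
by apply/simplex_chainZ/hf/hc.
Qed.

Lemma simplex_trans i b m T :
  simplex i b T -> simplex i (b + adeg L m) (trans m T).
Proof.
move=> [cT hT]; split; first by rewrite card_trans.
by move=> v /transP[w wT ->]; rewrite adegD (hT w) // addrC.
Qed.

Lemma simplex_chain_scale i b a m (c : schain) :
  simplex_chain i b c -> simplex_chain i (b + adeg L m) ((a *: 'X_[m]) *: c).
Proof.
rewrite schain_scaleXE => hc; apply: simplex_chainZ.
apply: simplex_chain_map hc => T hT; rewrite /= shift_chainU.
exact/simplex_chainU/simplex_trans.
Qed.

Lemma simplex_boundary i b c :
  simplex_chain i.+1 b c -> simplex_chain i b (bd c).
Proof.
apply: simplex_chain_map => T [cT hT] /=.
rewrite boundaryU face_boundaryE; apply: simplex_chain_sum => v vT.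
apply/simplex_chainZ/simplex_chainU; split.
  by move: cT; rewrite (cardfsD1 v) vT => -[].
by move=> w; rewrite in_fsetD1 => /andP[_ /hT].
Qed.

Lemma simplex_cone i b t c : adeg L t = b ->
  simplex_chain i b c -> simplex_chain i.+1 b (cone t c).
Proof.
move=> ht; apply: simplex_chain_map => T [cT hT] /=.
rewrite coneU /cone_face; case: ifPn => tT; first exact: simplex_chain0.
rewrite freegU1Z; apply/simplex_chainZ/simplex_chainU; split.
  by rewrite cardfsU1 tT cT.
by move=> w; rewrite !inE => /orP[/eqP ->|/hT].
Qed.

(** A cycle is the boundary of its cone from any vertex of one of its faces; such a vertex has
    degree [b], so the cone stays in the same fibre. *)
Lemma simplex_exact i b c : simplex_chain i.+1 b c -> bd c = 0 ->
  exists2 w, simplex_chain i.+2 b w & bd w = c.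
Proof.
move=> hc c0; case D: (dom c) => [|T s].
  exists 0; first exact: simplex_chain0.
  by rewrite linear0; apply/esym/eqP; rewrite -dom_eq0 D.
have [|cT hT] := hc T; first by rewrite D mem_head.
have [t tT] : exists t, t \in T by apply/fset0Pn; rewrite -cardfs_gt0 cT.
exists (cone t c); first by apply: simplex_cone => //; apply: hT.
by have := cone_boundary t c; rewrite c0 linear0 addr0.
Qed.

(** Position [i] holds the faces with [i.+1] vertices; the empty face is left to be the target of
    the augmentation. *)
Definition simplex_gmod (i : nat) : gmod L k :=
  @Gmod n L k schain (simplex_chain i.+1) (@simplex_chain0 _)
    (@simplex_chainD _) (@simplex_chain_scale _).

Definition simplex_complex : gcomplex L k :=
  @Gcomplex n L k simplex_gmod (fun i => @sboundary n k)
    (fun i b c => @simplex_boundary i.+1 b c)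
    (fun i b c _ => boundary_boundary c).

Lemma simplex_complex_exact : gexact simplex_complex.
Proof. by move=> i b c hc /(simplex_exact hc). Qed.

(** The minimum on naturals has no neutral element, so the fold starts from an element of [T], which
    does not change the minimum when [T] is nonempty. *)
Definition mgcd (T : {fset X}) : X :=
  [multinom \big[minn/head 0%MM T i]_(v <- T) v i | i < n].

Lemma mgcdP (T : {fset X}) : T <> fset0 -> is_gcd T (mgcd T).
Proof.
move=> T0; have hT : head 0%MM T \in T.
  have /fset0Pn [v] : T != fset0 by apply/eqP.
  have -> : (v \in T) = (v \in enum_fset T) by [].
  have -> : (head 0%MM T \in T) = (head 0%MM T \in enum_fset T) by [].
  by case: (enum_fset T) => //= w s _; apply: mem_head.
split=> [v vT|h hh]; apply/mnm_lepP => i; rewrite mnmE.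
  suff min_le (s : seq X) x : v \in s -> (\big[minn/x]_(w <- s) w i <= v i)%N.
    exact: min_le.
  elim: s => //= w s IH.
  by rewrite inE big_cons geq_min => /orP[/eqP ->|/IH ->]; rewrite ?leqnn ?orbT.
rewrite big_seq; apply: (big_ind (fun m => (h i <= m)%N)).
- by move/mnm_lepP: (hh _ hT).
- by move=> x y hx hy; rewrite leq_min hx.
- by move=> v /hh /mnm_lepP.
Qed.

Lemma is_gcd_uniq (T : {fset X}) g h : is_gcd T g -> is_gcd T h -> g = h.
Proof.
move=> [g1 g2] [h1 h2]; apply/mnmP => i; apply/eqP; rewrite eqn_leq.
by rewrite (mnm_lepP (h2 _ g1)) (mnm_lepP (g2 _ h1)).
Qed.

Lemma trans_eq0 m (T : {fset X}) : (trans m T == fset0) = (T == fset0).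
Proof. by rewrite -!cardfs_eq0 card_trans. Qed.

Lemma mgcd_trans m (T : {fset X}) : T <> fset0 -> mgcd (trans m T) = (m + mgcd T)%MM.
Proof.
move=> T0; have [g1 g2] := mgcdP T0.
apply: (@is_gcd_uniq (trans m T)).
  by apply: mgcdP => /eqP; rewrite trans_eq0 => /eqP.
split=> [_ /transP[w /g1/mnm_lepP gw ->]|h hh].
  by apply/mnm_lepP => i; rewrite !mnmDE leq_add2l.
have /g2 hm : forall v, v \in T -> (h - m <= v)%MM.
  move=> v vT; have := hh (m + v)%MM; rewrite mem_trans => /(_ vT)/mnm_lepP hv.
  by apply/mnm_lepP => i; rewrite mnmBE leq_subLR -mnmDE hv.
by apply/mnm_lepP => i; move/mnm_lepP/(_ i): hm; rewrite mnmBE leq_subLR mnmDE.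
Qed.

(** The representative of gcd 1 in the orbit of [T] under translation. *)
Definition mprim (T : {fset X}) : {fset X} := [fset (v - mgcd T)%MM | v in T].

Lemma trans_mprim (T : {fset X}) : trans (mgcd T) (mprim T) = T.
Proof.
have [->|/eqP T0] := eqVneq T fset0; first by rewrite /mprim /trans !imfset0.
have [g1 _] := mgcdP T0.
apply/fsetP => v; apply/transP/idP => [[w /imfsetP [u /= uT ->] ->]|vT].
  by rewrite addmC submK // g1.
exists (v - mgcd T)%MM; first by apply/imfsetP; exists v.
by rewrite addmC submK // g1.
Qed.

Lemma mprim_trans m (T : {fset X}) : mprim (trans m T) = mprim T.
Proof.
have [->|/eqP T0] := eqVneq T fset0; first by rewrite /mprim /trans !imfset0.
have E v : (m + v - (m + mgcd T) = v - mgcd T)%MM.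
  by apply/mnmP => i; rewrite !mnmE subnDl.
apply/fsetP => v; apply/imfsetP/imfsetP => [[_ /= /transP[w wT ->] ->]|[w /= wT ->]].
  by exists w; rewrite // mgcd_trans // E.
by exists (m + w)%MM; rewrite /= ?mem_trans // mgcd_trans // E.
Qed.

Lemma simplex_untrans i b m (T : {fset X}) :
  simplex i b (trans m T) -> simplex i (b - adeg L m) T.
Proof.
move=> [cT hT]; split; first by rewrite -cT card_trans.
move=> v vT; rewrite -(hT (m + v)%MM) ?mem_trans //.
by rewrite adegD addrC addKr.
Qed.

(** The faces of gcd 1 are an [R]-basis: every nonempty face is the translate of its primitive part
    by its gcd. Lifts of the primitive faces are chosen and extended by translation. *)
Lemma simplex_proj i : gproj (simplex_gmod i).
Proof.
move=> Y Z d g hg.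
have /ClassicalEpsilon.constructive_indefinite_description [z hz] :
    exists z : {fset X} -> Z, forall T b, simplex i.+1 b T ->
      ghom b (z T) /\ d (z T) = g << T >>.
  have zT T : exists z : Z, forall b, simplex i.+1 b T ->
      ghom b z /\ d z = g << T >>.
    have [[b hb]|nb] := Classical_Prop.classic (exists b, simplex i.+1 b T).
      have [z z1 z2] := hg _ _ (simplex_chainU hb); exists z => b' [cT hT].
      (* A nonempty face determines its degree, so the lift found for [b] serves every [b']. *)
      suff -> : b' = b by [].
      have /fset0Pn [v vT] : T != fset0 by rewrite -cardfs_gt0 cT.
      by rewrite -(hT v) // hb.2.
    by exists 0 => b hb; case: nb; exists b.
  pose choice T := ClassicalEpsilon.constructive_indefinite_description _ (zT T).
  by exists (fun T => sval (choice T)) => T; apply: svalP (choice T).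
have [m T|h hE] := @schain_lift n k Z
    (fun T => if T == fset0 then 0 else 'X_[mgcd T] *: z (mprim T)).
  rewrite trans_eq0; case: eqP => [|T0]; first by rewrite scaler0.
  by rewrite mgcd_trans // mprim_trans mpolyXD scalerA.
have hT b (T : {fset X}) : simplex i.+1 b T ->
    ghom b (h << T >>) /\ d (h << T >>) = g << T >>.
  move=> hT; have T0 : T != fset0 by rewrite -cardfs_gt0 hT.1.
  have hT' := hT; rewrite -{1}(trans_mprim T) in hT'.
  have [h1 h2] := hz _ _ (simplex_untrans hT').
  rewrite hE (negPf T0); split.
    by have := ghomZ 1 (mgcd T) h1; rewrite scale1r subrK.
  have E : (<< T >> : schain) = 'X_[mgcd T] *: (<< mprim T >> : schain).
    by rewrite schain_scaleX1 shift_chainU trans_mprim.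
  by rewrite linearZ /= h2 [in RHS]E [RHS]linearZ.
have hc b (c : schain) : simplex_chain i.+1 b c -> ghom b (h c) /\ d (h c) = g c.
  move=> hc; rewrite -[c]freeg_sumE.
  have E T : << coeff T c *g T >> = (coeff T c)%:MP *: (<< T >> : schain) :> schain.
    by rewrite schain_scaleC -freegU1Z.
  rewrite (eq_bigr (fun T => (coeff T c)%:MP *: (<< T >> : schain))); last first.
    by move=> T _; apply: E.
  rewrite [h _]linear_sum [g _]linear_sum linear_sum big_seq; split.
    apply: ghom_sum => T /hc /hT [h1 _]; rewrite linearZ; exact: ghomZc.
  rewrite big_seq [RHS]big_seq; apply: eq_bigr => T /hc /hT [_ h2].
  by rewrite !linearZ /= h2.
by exists h => b c /hc [].
Qed.

End SimplexComplex.

(** * Homology of the gcd complex *)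

Section Augmentation.

Variables (n : nat) (L : zmodClosed 'rV[int]_n) (k : fieldType).

Local Notation Q := (Quotient.quot L).
Local Notation R := {mpoly k[n]}.
Local Notation X := 'X_{1..n}.
Local Notation kchain := {freeg {fset X} / k}.
Local Notation schain := (schain n k).
Local Notation bd := (@boundary k _ X).
Local Notation simplex_complex := (simplex_complex L k).

Local Open Scope fset_scope.
Local Open Scope ring_scope.

Lemma is_chain_simplex i (b : Q) (c : kchain) :
  is_chain (gcd_complex b) i c -> simplex_chain i b c.
Proof.
move=> hc T /hc [[->|[_ hT _]] cT]; split=> //.
Qed.

(** A face of gcd different from 1 is its primitive part multiplied by a nonconstant monomial. The
    index [i.+1] excludes the empty face, which is no such multiple. *)
Lemma is_chain_in_max i (b : Q) (c : kchain) :
  is_chain (gcd_complex b) i.+1 c -> in_max (c : schain).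
Proof.
move=> hc; rewrite -[c]freeg_sumE.
rewrite (eq_bigr (fun T => (coeff T c)%:MP *: (<< T >> : schain))); last first.
  by move=> T _; rewrite schain_scaleC -freegU1Z.
rewrite big_seq; apply: in_max_sum => T /hc [hT cT]; apply: in_maxZr.
case: hT => [T0|[T0 _ [g hg g0]]]; first by rewrite T0 cardfs0 in cT.
rewrite (_ : << T >> = 'X_[mgcd T] *: (<< mprim T >> : schain)).
  by apply: in_maxX; rewrite (is_gcd_uniq (mgcdP T0) hg); apply/eqP.
by rewrite schain_scaleX1 shift_chainU trans_mprim.
Qed.

Lemma dom_shift_chain m (c : kchain) T :
  T \in dom (shift_chain m c) -> exists S, T = trans m S.
Proof.
rewrite -[c]freeg_sumE linear_sum => /dom_sum_subset /flattenP [s].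
move=> /mapP [S _ ->]; rewrite freegU1Z linearZ /= => /domZ_subset.
by rewrite shift_chainU domU1 inE => /eqP ->; exists S.
Qed.

(** A face occurring in $\sum_j x_j y_j$ occurs in some $x_j y_j$, hence is a translate by $x_j$,
    and $x_j$ divides its gcd. *)
Lemma in_max_is_chain i (b : Q) (c : schain) :
  simplex_chain i.+1 b c -> in_max c -> is_chain (gcd_complex b) i.+1 c.
Proof.
move=> hc [y cE] T Tc; have [cT hT] := hc T Tc; split=> //; right.
have T0 : T <> fset0 by move=> T0; rewrite T0 cardfs0 in cT.
split=> //; exists (mgcd T); first exact: mgcdP.
move: Tc; rewrite cE => /dom_sum_subset /flattenP [s /mapP [j _ ->]].
rewrite schain_scaleX1 => /dom_shift_chain [S TE] g0.
have S0 : S <> fset0 by move=> S0; apply: T0; rewrite TE S0 /trans imfset0.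
move/mnmP/(_ j): g0; rewrite TE mgcd_trans // mnmDE mnm1E eqxx mnm0E.
by [].
Qed.

(** The sum of the coefficients; on homogeneous polynomials its kernel is the lattice ideal. *)
Definition aug (p : R) : k := p.@[fun=> 1].

Lemma augX m : aug 'X_[m] = 1.
Proof. by rewrite /aug mevalX big1 // => i _; rewrite expr1n. Qed.

Lemma augE p : aug p = \sum_(m <- msupp p) p@_m.
Proof.
rewrite {1}[p]mpolyE /aug raddf_sum /=; apply: eq_bigr => m _.
by rewrite mevalZ -/(aug _) augX mulr1.
Qed.

Lemma lattice_ideal_aug p : lattice_ideal L k p -> aug p = 0.
Proof.
move=> [s [hs ->]]; rewrite /aug raddf_sum /= big_seq big1 // => q /hs [u [v [_ ->]]].
by rewrite mevalM mevalB -!/(aug _) !augX subrr mulr0.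
Qed.

Lemma aug_lattice_ideal b p : (forall m, m \in msupp p -> adeg L m = b) ->
  aug p = 0 -> lattice_ideal L k p.
Proof.
move=> hp p0; case D: (msupp p) => [|m0 s].
  by exists [::]; rewrite big_nil; split=> //; apply: msuppnil0.
(* The coefficients of [p] sum to zero, so $p=\sum_m p_m(x^m-x^{m_0})$ for any fixed monomial
   $x^{m_0}$ of its support. *)
exists [seq ((p@_m)%:MP, 'X_[m] - 'X_[m0]) | m <- msupp p]; split.
  move=> _ /mapP [m mp ->] /=; exists m, m0; split=> //.
  by apply/adeg_eq; rewrite !hp // D mem_head.
rewrite big_map /= {1}[p]mpolyE.
under [RHS]eq_bigr => m _ do rewrite mulrBr !mul_mpolyC.
by rewrite sumrB -scaler_suml -augE p0 scale0r subr0.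
Qed.

(** The face $\{1\}$ generates position 0 freely; it identifies that position with [R], and the
    boundary with the augmentation [aug]. *)
Definition vertex0 : schain := (<< [fset (0%MM : X)] >> : kchain).

Lemma trans_fset1 (m v : X) : trans m [fset v] = [fset (m + v)%MM].
Proof. by rewrite /trans imfset_fset1. Qed.

Lemma boundary_vertex (v : X) : bd << [fset v] >> = << fset0 >>.
Proof.
rewrite boundaryU face_boundaryE big_seq_fset1 fsetDv.
have -> : pos [fset v] v = 0%N; last by rewrite scale1r.
rewrite /pos; apply/eqP; rewrite cardfs_eq0; apply/eqP/fsetP => w.
by rewrite !inE /=; case: eqVneq => [->|] //=; rewrite ltxx.
Qed.

Lemma boundary_vertex0 p : bd (p *: vertex0) = aug p *: << fset0 >>.
Proof.
rewrite [p *: _]schain_scaleE linear_sum augE scaler_suml; apply: eq_bigr => m _.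
by rewrite linearZ /= shift_chainU trans_fset1 boundary_vertex.
Qed.

Lemma simplex1P (b : Q) T : simplex 1 b T -> exists2 v, T = [fset v] & adeg L v = b.
Proof.
move=> [/eqP/cardfs1P [v ->] hv]; exists v => //.
by apply: hv; rewrite inE.
Qed.

Definition row_complex (G : graded_complex L k) : gcomplex L k :=
  @Gcomplex n L k (fun i => row_gmod k (@shift _ _ _ G i))
    (fun i => mulmxr (diff G i) : {linear 'rV[R]_(rank G i.+1) -> 'rV[R]_(rank G i)})
    (fun i b x hx => homogeneousM (@diff_degree _ _ _ G i) hx)
    (fun i b x _ => etrans (esym (mulmxA _ _ _))
       (etrans (congr1 (mulmx x) (diff_diff G i)) (mulmx0 _ _))).

Lemma row_complex_proj G i : gproj (gm (row_complex G) i).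
Proof. exact: row_proj. Qed.

Section StartsAtR.

Variable G : graded_complex L k.
Hypothesis hG : starts_at_R G.

Lemma starts_at_R_index : exists j0 : 'I_(rank G 0), forall j, j = j0.
Proof.
have rk : (0 < rank G 0)%N by rewrite hG.1.
exists (Ordinal rk) => j; apply/val_inj => /=.
by have := ltn_ord j; rewrite {2}hG.1 ltnS leqn0 => /eqP.
Qed.

Lemma start_to_simplex : exists2 u0 : {linear 'rV[R]_(rank G 0) -> schain},
  forall p, u0 (const_mx p) = p *: vertex0 &
  @ghom_map _ _ _ (gm (row_complex G) 0) (gm simplex_complex 0) u0.
Proof.
have [j0 hj] := starts_at_R_index.
pose u (v : 'rV[R]_(rank G 0)) := v 0 j0 *: vertex0.
have ulin : linear u by move=> a x y; rewrite /u !mxE scalerDl scalerA.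
pose uL := GRing.isLinear.Build R _ _ *:%R u ulin.
exists (HB.pack u uL : {linear 'rV[R]_(rank G 0) -> schain}) => [p|b x hx] /=.
  by rewrite /u mxE.
apply: (@ghomZp _ _ _ (simplex_gmod L k 0) 0) => [|m /hx ->]; last by rewrite hG.2.
apply: simplex_chainU; split; first exact: cardfs1.
by move=> v; rewrite inE => /eqP ->; rewrite adeg0.
Qed.

Lemma simplex_to_start : exists2 v0 : {linear schain -> 'rV[R]_(rank G 0)},
  forall v : X, v0 << [fset v] >> = const_mx 'X_[v] &
  @ghom_map _ _ _ (gm simplex_complex 0) (gm (row_complex G) 0) v0.
Proof.
(* The gcd of a singleton is its element; faces of other sizes also belong to [schain] and are sent
   to 0. *)
pose f (T : {fset X}) : 'rV[R]_(rank G 0) :=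
  if #|` T| == 1%N then const_mx 'X_[mgcd T] else 0.
have [m T|v0 v0E] := @schain_lift n k _ f.
  rewrite /f card_trans; case: eqP => [cT|_]; last by rewrite scaler0.
  rewrite mgcd_trans; last by move=> T0; rewrite T0 cardfs0 in cT.
  by apply/rowP => j; rewrite !mxE mpolyXD.
have v0v v : v0 << [fset v] >> = const_mx 'X_[v].
  rewrite v0E /f cardfs1 eqxx; congr (const_mx 'X_[_]).
  apply: (@is_gcd_uniq _ [fset v]).
    by apply: mgcdP => /eqP; rewrite -cardfs_eq0 cardfs1.
  split=> [w|h hh]; last by apply: hh; rewrite inE.
  by rewrite inE => /eqP ->; rewrite lepm_refl.
exists v0 => // b c hc; rewrite -[c]freeg_sumE.
rewrite (eq_bigr (fun T => (coeff T c)%:MP *: (<< T >> : schain))); last first.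
  by move=> T _; rewrite schain_scaleC -freegU1Z.
rewrite [v0 _]linear_sum big_seq.
apply: (@ghom_sum _ _ _ (gm (row_complex G) 0)) => T /hc /simplex1P [v -> hv].
rewrite linearZ; apply: (@ghomZc _ _ _ (gm (row_complex G) 0)) => /= j m.
by rewrite v0v mxE msuppX inE hG.2 add0r => /eqP ->.
Qed.

End StartsAtR.

(** Exactness gives some preimage; its component of degree [b] is a homogeneous one. *)
Lemma row_exact (I : R -> Prop) (G : graded_complex L k) :
  free_resolution I G -> gexact (row_complex G).
Proof.
move=> [_ _ _ exG] i b x hx dx; have [w wE] := exG i x dx.
exists (hrow (@shift _ _ _ G i.+2) b w); first exact: hrow_hom.
by rewrite /= -(hrowM _ _ (@diff_degree _ _ _ G i.+1)) -wE; apply: hrow_id.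
Qed.

Lemma row_exact0 (I : R -> Prop) (G : graded_complex L k) b p :
  free_resolution I G -> I p ->
  homogeneous (@shift _ _ _ G 0) b (const_mx p) ->
  exists2 w, homogeneous (@shift _ _ _ G 1) b w & w *m diff G 0 = const_mx p.
Proof.
move=> [_ _ hI _] /hI [w wE] hp.
exists (hrow (@shift _ _ _ G 1) b w); first exact: hrow_hom.
by rewrite -(hrowM _ _ (@diff_degree _ _ _ G 0)) wE; apply: hrow_id.
Qed.

End Augmentation.

(** * Comparison maps between finite resolutions and the simplex complex *)

Section Comparison.

Variables (n : nat) (L : zmodClosed 'rV[int]_n) (k : fieldType).

Local Notation Q := (Quotient.quot L).
Local Notation R := {mpoly k[n]}.
Local Notation X := 'X_{1..n}.
Local Notation kchain := {freeg {fset X} / k}.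
Local Notation schain := (schain n k).
Local Notation bd := (@boundary k _ X).
Local Notation simplex_complex := (simplex_complex L k).
Local Notation cst := (@cst n k _ _).
Local Notation I := (lattice_ideal L k).

Local Open Scope fset_scope.
Local Open Scope ring_scope.

Lemma start_const (G : graded_complex L k) : starts_at_R G ->
  forall v : 'rV[R]_(rank G 0), exists p, v = const_mx p.
Proof.
move=> /starts_at_R_index [j0 hj] v; exists (v 0 j0).
by apply/rowP => j; rewrite mxE (hj j).
Qed.

Lemma start_hom (G : graded_complex L k) (hG : starts_at_R G) b (p : R) :
  homogeneous (@shift _ _ _ G 0) b (const_mx p) <->
  forall m, m \in msupp p -> adeg L m = b.
Proof.
have [j0 hj] := starts_at_R_index hG; split=> [hp m mp|hp j m].
  by rewrite (hp j0 m) ?mxE // hG.2 add0r.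
by rewrite mxE => /hp ->; rewrite hG.2 add0r.
Qed.

Lemma row_to_row (G G' : graded_complex L k) :
  free_resolution I G -> free_resolution I G' ->
  exists2 u : forall i, {linear gm (row_complex G) i -> gm (row_complex G') i},
    chain_map u & forall p, u 0%N (const_mx p) = const_mx p.
Proof.
move=> hG hG'; have [sG _ IG _] := hG; have [sG' _ _ _] := hG'.
(* Both ranks are 1 only up to a proof, so the identity of [R] is written as a constant matrix. *)
pose M : 'M[R]_(rank G 0, rank G' 0) := const_mx 1.
pose u0 : {linear gm (row_complex G) 0 -> gm (row_complex G') 0} := mulmxr M.
have u0E p : u0 (const_mx p) = const_mx p.
  have [j0 hj] := starts_at_R_index sG.
  apply/rowP => j; rewrite !mxE (bigD1 j0) //= big1 => [|i].
    by rewrite !mxE mulr1 addr0.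
  by rewrite (hj i) eqxx.
have hu0 : ghom_map u0.
  move=> b v hv; have [p vE] := start_const sG v.
  by move: hv; rewrite vE u0E => /start_hom - /(_ sG) /(start_hom sG').
have [|u uE uP] := @chain_map_lift _ _ _ (row_complex G) (row_complex G') u0
    (@row_complex_proj _ _ _ G) (row_exact hG') hu0.
  move=> b x hx; have [p pE] := start_const sG (x *m diff G 0).
  have [w hw wE] : exists2 w, homogeneous (@shift _ _ _ G' 1) b w &
      w *m diff G' 0 = const_mx p.
    apply: row_exact0 hG' _ _; first by apply/IG; exists x.
    apply/(start_hom sG')/(start_hom sG); rewrite -pE.
    exact: (gd_hom hx).
  by exists w => //; rewrite [LHS]wE -[RHS]/(u0 (x *m diff G 0)) pE u0E.
by exists u => // p; rewrite uE u0E.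
Qed.

Lemma row_to_simplex (G : graded_complex L k) : free_resolution I G ->
  exists2 u : forall i, {linear gm (row_complex G) i -> gm simplex_complex i},
    chain_map u & forall p, u 0%N (const_mx p) = p *: vertex0 n k.
Proof.
move=> hG; have [sG _ IG _] := hG.
have [u0 u0E hu0] := start_to_simplex sG.
have [|u uE uP] := @chain_map_lift _ _ _ (row_complex G) simplex_complex u0
    (@row_complex_proj _ _ _ G) (@simplex_complex_exact _ _ _) hu0.
  (* Exactness at the vertices: the augmentation vanishes because the image of the first
     differential is the lattice ideal. *)
  move=> b x hx; apply: (@simplex_exact _ L k 0 b) => /=.
    by apply: hu0; apply: (gd_hom hx).
  have [p pE] := start_const sG (x *m diff G 0).
  rewrite pE u0E boundary_vertex0 (@lattice_ideal_aug _ L) ?scale0r //.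
  by apply/IG; exists x.
by exists u => // p; rewrite uE u0E.
Qed.

Lemma simplex_to_row (G : graded_complex L k) : free_resolution I G ->
  exists2 u : forall i, {linear gm simplex_complex i -> gm (row_complex G) i},
    chain_map u & forall v : X, u 0%N (<< [fset v] >> : schain) = const_mx 'X_[v].
Proof.
move=> hG; have [sG _ IG _] := hG.
have [v0 v0E hv0] := simplex_to_start sG.
have [u0 u0E hu0] := start_to_simplex sG.
(* Used below to read off [aug p = 0] from the fact that the boundary of a boundary is zero. *)
have u0v0 (b : Q) (c : schain) : simplex_chain 1 b c -> u0 (v0 c) = c.
  move=> hc; rewrite -[c]freeg_sumE.
  rewrite (eq_bigr (fun T => (coeff T c)%:MP *: (<< T >> : schain))); last first.
    by move=> T _; rewrite schain_scaleC -freegU1Z.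
  rewrite [v0 _]linear_sum linear_sum big_seq [RHS]big_seq.
  apply: eq_bigr => T /hc /simplex1P [v -> hv].
  rewrite [v0 _]linearZ [LHS]linearZ /= v0E u0E schain_scaleX1 shift_chainU.
  by rewrite trans_fset1 addm0.
have [|u uE uP] := @chain_map_lift _ _ _ simplex_complex (row_complex G) v0
    (@simplex_proj _ _ _) (row_exact hG) hv0.
  move=> b x hx; have hbx : simplex_chain 1 b (bd x) by apply: simplex_boundary.
  have [p pE] := start_const sG (v0 (bd x)).
  have hp : homogeneous (@shift _ _ _ G 0) b (const_mx p).
    by rewrite -pE; apply: hv0.
  have p0 : aug p = 0.
    have : bd (u0 (v0 (bd x))) = 0 by rewrite (u0v0 b) // boundary_boundary.
    rewrite pE u0E boundary_vertex0 => /(congr1 (coeff fset0)).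
    by rewrite coeffZ coeffU eqxx !mulr1 coeff0.
  have [w hw wE] : exists2 w, homogeneous (@shift _ _ _ G 1) b w &
      w *m diff G 0 = const_mx p.
    apply: (row_exact0 hG _ hp).
    apply: (@aug_lattice_ideal _ L k b) => //; apply/(start_hom sG); exact: hp.
  by exists w => //; rewrite -pE in wE; rewrite [LHS]wE.
by exists u => // v; rewrite uE v0E.
Qed.

Section Minimal.

Variable F : graded_complex L k.
Hypothesis hF : minimal_free_resolution I F.

Lemma minimal_diff i (v : 'rV[R]_(rank F i.+1)) : in_max (v *m diff F i).
Proof.
apply/red_in_max/rowP => j; rewrite !mxE.
by have := irrelevant_mcoeff0 (hF.2 i v j); rewrite mxE.
Qed.

Lemma minimal_tensor_diff i : tensor_diff F i = 0.
Proof.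
apply/row_matrixP => l; rewrite row0.
have /red_in_max := minimal_diff (delta_mx 0 l).
by rewrite -rowE => <-; apply/rowP => j; rewrite !mxE.
Qed.

(** Such an endomorphism is homotopic to the identity, and both terms of the homotopy formula
    involve the differential of [F], which lands in $(x_1,\dots,x_n)F$. *)
Lemma minimal_endo
    (u : forall i, {linear gm (row_complex F) i -> gm (row_complex F) i}) :
  chain_map u ->
  (forall b (x : gm (row_complex F) 0), ghom b x -> u 0%N x = x) ->
  forall i b (x : gm (row_complex F) i), ghom b x -> in_max (u i x - x).
Proof.
move=> uP u0 [|i] b x hx; first by rewrite (u0 b) // subrr; apply: in_max0.
have [h hh hP] := chain_map_homotopic_id (@row_complex_proj _ _ _ F)
  (row_exact hF.1) uP u0.
rewrite (hP i b) // addrC addKr; apply: in_maxD; first exact: minimal_diff.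
by apply/in_max_map/minimal_diff.
Qed.

Lemma tensor_degree_cst i b (v : 'rV[k]_(rank F i)) :
  tensor_degree b v -> homogeneous (@shift _ _ _ F i) b (cst v).
Proof.
move=> hv j m; rewrite mxE msuppC; case: eqP => [//|/eqP /hv ->].
by rewrite inE => /eqP ->; rewrite adeg0 addr0.
Qed.

Lemma tensor_degree_red i b (x : 'rV[R]_(rank F i)) :
  homogeneous (@shift _ _ _ F i) b x -> tensor_degree b (red x).
Proof.
move=> hx j; rewrite mxE -mcoeff_msupp => /hx ->.
by rewrite adeg0 addr0.
Qed.

(* Transport along the two comparison maps between the minimal resolution F and
   the simplex complex S, followed by the connecting map of the simplex on the
   fibre relative to the gcd complex. *)
Lemma homology_of_tensor i (b : Q) : exists f : {linear 'rV[k]_(rank F i) -> kchain},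
  [/\ forall v, tensor_degree b v ->
        is_chain (gcd_complex b) i (f v) /\ bd (f v) = 0,
      forall v e, tensor_degree b v -> is_chain (gcd_complex b) i.+1 e ->
        bd e = f v -> v = 0
    & forall c, in_A b -> is_chain (gcd_complex b) i c -> bd c = 0 ->
        exists v e, [/\ tensor_degree b v, is_chain (gcd_complex b) i.+1 e
          & bd e = c - f v]].
Proof.
have [resF minF] := hF; have [sF _ _ _] := resF.
have [u [hu uP] u0] := row_to_simplex resF.
have [w [hw wP] w0] := simplex_to_row resF.
have wu0 b' (x : gm (row_complex F) 0) : ghom b' x -> w 0%N (u 0%N x) = x.
  move=> _; have [p ->] := start_const sF x.
  rewrite u0 linearZ /= [vertex0 _ _]/(<< _ >>) w0 mpolyX0.
  by apply/rowP => j; rewrite !mxE mulr1.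
have uw0 b' (c : gm simplex_complex 0) : ghom b' c -> u 0%N (w 0%N c) = c.
  move=> hc; rewrite -[c]freeg_sumE.
  rewrite (eq_bigr (fun T => (coeff T c)%:MP *: (<< T >> : schain))); last first.
    by move=> T _; rewrite schain_scaleC -freegU1Z.
  rewrite [w _ _]linear_sum linear_sum big_seq [RHS]big_seq.
  apply: eq_bigr => T /hc /simplex1P [v -> hv].
  rewrite [w _ _]linearZ [LHS]linearZ /= w0 u0 schain_scaleX1 shift_chainU.
  by rewrite trans_fset1 addm0.
have [g hg gP] := @chain_map_homotopic_id _ _ _ simplex_complex _ (@simplex_proj _ L k)
  (@simplex_complex_exact _ L k) (chain_map_comp (conj hw wP) (conj hu uP)) uw0.
have wu := minimal_endo (chain_map_comp (conj hu uP) (conj hw wP)) wu0.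
(* In positive degree, the boundary of the image of [v] is the image of its differential, a multiple
   of the variables by minimality. In degree 0 only the empty face can occur. *)
have umax (v : 'rV[k]_(rank F i)) : tensor_degree b v ->
    is_chain (gcd_complex b) i (bd (u i (cst v))).
  move=> /tensor_degree_cst hv; have := simplex_boundary (hu i b _ hv).
  case: i v hv => [|j] v hv huv.
    move=> T /huv [/cardfs0_eq -> _]; rewrite cardfs0; split=> //.
    by left.
  apply: in_max_is_chain => //; rewrite [bd _](uP j b _ hv).
  exact (in_max_map (u j) (minimal_diff _)).
pose f (v : 'rV[k]_(rank F i)) : kchain := bd (u i (cst v)).
have flin : linear f.
  move=> a v v'; rewrite /f.
  have -> : cst (a *: v + v') = a%:MP *: cst v + cst v'.
    by apply/rowP => j; rewrite !mxE mpolyCD mpolyCM.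
  by rewrite linearD [u _ (_ *: _)]linearZ /= schain_scaleC linearD linearZ.
pose fL := GRing.isLinear.Build k _ _ *:%R f flin.
exists (HB.pack f fL : {linear 'rV[k]_(rank F i) -> kchain}); split=> /=.
- by move=> v hv; split; [apply: umax | apply: boundary_boundary].
(* Injectivity: [u i (cst v) - e] is a cycle, hence a boundary. Under [w], boundaries and multiples
   of the variables both reduce to zero, so [w i (u i (cst v))] does, and with it [v]. *)
- move=> v e hv he ev; have hv' := tensor_degree_cst hv.
  have hue := hu i b _ hv'; have hes := is_chain_simplex he.
  have hy : simplex_chain i.+1 b (u i (cst v) - e).
    exact: (@ghomB _ _ _ (simplex_gmod L k i) b _ _ hue hes).
  have [|y hy1 hy2] := simplex_exact hy; first by rewrite linearB /= ev subrr.
  rewrite -[v](@cstK n); apply/red_in_max.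
  have wue : in_max (w i (u i (cst v))).
    have -> : u i (cst v) = (bd y : schain) + e by rewrite hy2 subrK.
    rewrite linearD; apply: in_maxD; last exact/in_max_map/(is_chain_in_max he).
    rewrite -[bd y]/(gd simplex_complex i y) -(wP i b) //; exact: minimal_diff.
  by rewrite -[cst v](subKr (w i (u i (cst v)))); apply: in_maxB => //; apply: (wu i b).
(* Surjectivity: since [b] is in the semigroup, its fibre has a vertex [t]. The cone of [c] from [t]
   has boundary [c], and its image under [w] reduces to the required [v]. *)
- move=> c [t ht] hc c0.
  have hz : simplex_chain i.+1 b (cone t c).
    by apply: simplex_cone => //; apply: is_chain_simplex.
  have zE : bd (cone t c) = c by have := cone_boundary t c; rewrite c0 linear0 addr0.
  set z : schain := cone t c in hz zE.
  have hwz := hw i b _ hz; have hv := tensor_degree_red hwz.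
  have [y hy yP] : exists2 y : schain, simplex_chain i.+2 b y &
      in_max (u i (w i z) - z - (bd y : schain)).
    (* In degree 0 the composite is the identity and [y = 0] works. Above, [y] is the homotopy
       applied to [z]; the other homotopy term is the image of [c], a multiple of the variables. *)
    case: {f flin fL} i hc @z hz zE hwz hv {umax} => [|j] hc z hz zE hwz hv.
      exists 0; first exact: simplex_chain0.
      by rewrite (uw0 b) // linear0 subrr subr0; apply: in_max0.
    exists (g j.+1 z); first exact: hg.
    rewrite [u _ _](gP j b) //.
    rewrite -[gd simplex_complex j.+1 _]/(bd (g j.+1 z) : schain).
    rewrite [z + _]addrC addrK [X in X - _]addrC addrK.
    rewrite -[gd simplex_complex j _]/(bd z) zE.
    exact (in_max_map (g j) (is_chain_in_max hc)).
  set v := red (w i z) in hv *; have hue := hu i b _ (tensor_degree_cst hv).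
  exists v, (z + (bd y : schain) - u i (cst v)); split=> //.
    apply: in_max_is_chain.
      apply: (@ghomB _ _ _ (simplex_gmod L k i)) => //.
      apply: (@ghomD _ _ _ (simplex_gmod L k i)) => //.
      exact: simplex_boundary.
    have -> : z + (bd y : schain) - u i (cst v) =
        u i (w i z - cst v) - (u i (w i z) - z - (bd y : schain)).
      have E (x a y1 y2 : schain) : y1 + y2 - a = (x - a) - (x - y1 - y2).
        by rewrite -[x - y1 - y2]addrA -opprD opprB [RHS]addrC subrKA.
      by rewrite linearB; apply: E.
    apply: in_maxB => //; apply: in_max_map; apply/red_in_max.
    by rewrite redB cstK subrr.
  rewrite linearB linearD /= boundary_boundary addr0 zE.
  by [].
Qed.

End Minimal.

End Comparison.

(** * Betti degrees *)

Section Betti.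

Variables (n : nat) (L : zmodClosed 'rV[int]_n) (k : fieldType).

Local Notation Q := (Quotient.quot L).
Local Notation R := {mpoly k[n]}.
Local Notation X := 'X_{1..n}.
Local Notation kchain := {freeg {fset X} / k}.
Local Notation bd := (@boundary k _ X).
Local Notation cst := (@cst n k _ _).
Local Notation I := (lattice_ideal L k).

Lemma is_chainB (D : {fset X} -> Prop) i (c d : kchain) :
  is_chain D i c -> is_chain D i d -> is_chain D i (c - d).
Proof. by move=> hc hd T /domB; rewrite mem_cat => /orP[/hc|/hd]. Qed.

Lemma is_chainZ (D : {fset X} -> Prop) i a (c : kchain) :
  is_chain D i c -> is_chain D i (a *: c).
Proof. by move=> hc T /domZ_subset /hc. Qed.

Section TensorDegree.

Variables (G : graded_complex L k) (i : nat).
Implicit Types v w : 'rV[k]_(rank G i).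

Lemma tensor_degree_delta (j : 'I_(rank G i)) :
  tensor_degree (shift j) (delta_mx 0 j : 'rV[k]_(rank G i)).
Proof.
move=> l; rewrite mxE eqxx /=; case: (eqVneq l j) => [->|] //=.
by rewrite eqxx.
Qed.

Lemma tensor_degree0 b : tensor_degree b (0 : 'rV[k]_(rank G i)).
Proof. by move=> j; rewrite mxE eqxx. Qed.

Lemma tensor_degreeD b v w :
  tensor_degree b v -> tensor_degree b w -> tensor_degree b (v + w).
Proof.
move=> hv hw j; rewrite !mxE => hj; have [vj|/hv //] := eqVneq (v 0 j) 0.
by apply: hw; apply: contraNneq hj => wj; rewrite vj wj addr0.
Qed.

Lemma tensor_degreeZ b a v : tensor_degree b v -> tensor_degree b (a *: v).
Proof. by move=> hv j; rewrite mxE mulf_eq0 negb_or => /andP[_ /hv]. Qed.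

Lemma tensor_degreeN b v : tensor_degree b v -> tensor_degree b (- v).
Proof. by rewrite -scaleN1r; apply: tensor_degreeZ. Qed.

End TensorDegree.

Variable F : graded_complex L k.
Hypothesis hF : minimal_free_resolution I F.

(** Computed from [F] itself, Tor has zero differentials, so in each degree the standard basis
    vectors of that degree form a basis of it. *)
Lemma shift_betti i (j : 'I_(rank F i)) : betti_degree I i (shift j).
Proof.
split; first exact: shift_in_A.
pose J := [set l | @shift _ _ _ F i l == shift j].
exists #|J|; last by apply/eqP; rewrite -lt0n; apply/card_gt0P; exists j; rewrite inE.
exists F; first by case: hF.
exists (fun l => delta_mx 0 (enum_val l)); split=> [l|v [hv _]].
  have := enum_valP l; rewrite inE => /eqP <-.
  split; first exact: tensor_degree_delta.
  by case: (i) (enum_val l) => //= i' j'; rewrite minimal_tensor_diff // mulmx0.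
have vE (c : 'rV[k]_#|J|) : (forall l, c 0 l = v 0 (enum_val l)) <->
    v = \sum_(l < #|J|) c 0 l *: delta_mx 0 (enum_val l).
  split=> [hc|-> l].
    apply/rowP => x; rewrite summxE.
    have [xJ|xJ] := boolP (x \in J).
      rewrite (bigD1 (enum_rank_in xJ x)) //= big1 => [|l lx].
        by rewrite !mxE hc enum_rankK_in // !eqxx mulr1 addr0.
      rewrite !mxE eqxx /= [x == _]eq_sym.
      case: eqP => [lE|_]; last by rewrite mulr0.
      by case/eqP: lx; apply: enum_val_inj; rewrite enum_rankK_in // lE.
    rewrite big1 => [|l _].
      by apply: contraNeq xJ => /hv hx; rewrite inE hx.
    rewrite !mxE eqxx /=; case: eqP => [xE|_]; last by rewrite mulr0.
    by rewrite xE enum_valP in xJ.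
  rewrite summxE (bigD1 l) //= big1 => [|l' ll'].
    by rewrite !mxE !eqxx mulr1 addr0.
  by rewrite !mxE eqxx /= (inj_eq enum_val_inj) eq_sym (negPf ll') mulr0.
exists (\row_l v 0 (enum_val l)); split.
  exists 0; first by move=> l; rewrite mxE eqxx.
  rewrite mul0mx -[in RHS]((vE _).1 (fun l => mxE _ _ 0 l)) subrr //.
move=> c [w _]; rewrite minimal_tensor_diff // mulmx0 => /esym/eqP.
by rewrite subr_eq0 => /eqP /vE hc; apply/rowP => l; rewrite mxE hc.
Qed.

(** Tor may come from another resolution [G]. If [F] has no generator of degree [b], then going from
    [G] to [F] and back is zero modulo the variables in that degree; being homotopic to the
    identity, it makes every cycle a boundary. *)
Lemma betti_shift i b : betti_degree I i b -> exists j : 'I_(rank F i), shift j = b.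
Proof.
move=> [_ [m [G resG [z [hz zP]] m0]]].
have [resF minF] := hF.
have [sG _ _ _] := resG.
have [u [hu uP] u0] := row_to_row resG resF.
have [w [hw wP] w0] := row_to_row resF resG.
have wu0 b' (x : gm (row_complex G) 0) : ghom b' x -> w 0%N (u 0%N x) = x.
  by move=> _; have [p ->] := start_const sG x; rewrite u0 w0.
have [h hh hP] := chain_map_homotopic_id (@row_complex_proj _ _ _ G)
  (row_exact resG) (chain_map_comp (conj hu uP) (conj hw wP)) wu0.
have [/existsP[j /eqP]|/existsPn nj] := boolP [exists j : 'I_(rank F i), shift j == b].
  by exists j.
have umax (v : 'rV[k]_(rank G i)) : tensor_degree b v -> in_max (w i (u i (cst v))).
  move=> /tensor_degree_cst /(hu i) hv; apply/in_max_map/red_in_max/rowP => j.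
  rewrite !mxE; apply: contraNeq (nj j).
  by rewrite -mcoeff_msupp => /hv ->; rewrite adeg0 addr0.
have ZB (v : 'rV[k]_(rank G i)) : tensor_degree b v -> tensor_cycle v ->
    exists2 x, tensor_degree b x & x *m tensor_diff G i = v.
  case: (i) v umax => [|i'] v umax hv cv.
    exists 0; first exact: tensor_degree0.
    have := umax v hv; rewrite (wu0 b); last exact: tensor_degree_cst.
    by move=> /red_in_max; rewrite cstK mul0mx => ->.
  have hc := tensor_degree_cst hv.
  exists (- red (h i'.+1 (cst v))).
    exact/tensor_degreeN/tensor_degree_red/hh.
  pose x : 'rV[R]_(rank G i'.+2) := h i'.+1 (cst v).
  pose y : 'rV[R]_(rank G i'.+1) := h i' (cst v *m diff G i').
  have y0 : red y = 0.
    by apply/red_in_max/in_max_map/red_in_max; rewrite redM cstK.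
  have E : w i'.+1 (u i'.+1 (cst v)) = cst v + (x *m diff G i'.+1 + y).
    exact: (hP i' b).
  have /red_in_max := umax v hv; rewrite E redD redD y0.
  rewrite addr0 cstK redM => /eqP; rewrite addr_eq0 => /eqP vE.
  by rewrite mulNmx [RHS]vE.
case: m m0 z hz zP => // m _ z hz zP.
have zB (c : 'rV[k]_m.+1) : exists2 x, tensor_degree b x &
    x *m tensor_diff G i = 0 - \sum_l c 0 l *: z l.
  apply: ZB.
    rewrite sub0r; apply: tensor_degreeN.
    apply: big_ind => [|x y|l _].
    - exact: tensor_degree0.
    - exact: tensor_degreeD.
    - by apply: tensor_degreeZ; case: (hz l).
  case: (i) z hz {zP umax} => //= i' z hz.
  rewrite mulmxBl mul0mx mulmx_suml big1 ?subrr // => l _.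
  by rewrite -scalemxAl (hz l).2 scaler0.
have [|c [_ cu]] := zP 0.
  split; first exact: tensor_degree0.
  by case: (i) => //= i'; rewrite mul0mx.
(* All combinations of the [z l] are boundaries, so these two rows both represent the zero class,
   against uniqueness of coefficients. *)
have /rowP/(_ ord0) : 0 = const_mx 1 :> 'rV[k]_m.+1.
  by rewrite -(cu 0 (zB 0)) -(cu _ (zB (const_mx 1))).
by rewrite !mxE => /esym/eqP; rewrite oner_eq0.
Qed.

(** Concluding with equality of indices makes the degrees pairwise distinct as well, since the order
    is reflexive. *)
Definition incomparable r (s : 'I_r -> Q) : Prop :=
  forall j j', geA (s j) (s j') -> j = j'.

Definition incomparable_shifts (G : graded_complex L k) : Prop :=
  forall i, incomparable (@shift _ _ _ G i).

(** Betti degrees are the shifts of [F]. Incomparability leaves one generator in each of them, hence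
    a one-dimensional homology. Conversely, minimality makes comparable shifts equal, and two
    generators of equal degree would give independent homology classes. *)
Lemma incomparable_shiftsP :
  incomparable_shifts F <->
  forall i (b : Q), betti_degree I i b ->
    minimal_betti_degree I i b /\ reduced_homology_dim k (gcd_complex b) i 1.
Proof.
split=> [incF i b hb|H i j j' jj'].
  have [j jb] := betti_shift hb; split.
    split=> // c /betti_shift [j' <-]; rewrite -jb => jj'.
    by rewrite (incF _ _ _ jj').
  have [f [f1 f2 f3]] := homology_of_tensor hF i b.
  have hj : tensor_degree b (delta_mx 0 j : 'rV[k]_(rank F i)).
    by rewrite -jb; apply: tensor_degree_delta.
  have vE v : tensor_degree b v -> v = v 0 j *: delta_mx 0 j.
    move=> hv; apply/rowP => l; rewrite !mxE eqxx /=.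
    case: eqVneq => [->|lj]; first by rewrite mulr1.
    rewrite mulr0; apply: contraNeq lj => /hv lb; apply/eqP/incF.
    by rewrite lb jb; apply: geA_refl.
  exists (fun _ => f (delta_mx 0 j)); split=> [_|c [hc c0]]; first exact: f1.
  have [v [e [hv he eE]]] := f3 c hb.1 hc c0.
  exists (const_mx (v 0 j)); split.
    by exists e => //; rewrite eE big_ord1 mxE -linearZ -vE.
  move=> a [e' he']; rewrite big_ord1 => e'E.
  apply/rowP => l; rewrite mxE (ord1 l); apply/eqP; rewrite -subr_eq0.
  have : (v 0 j - a 0 ord0) *: delta_mx 0 j = 0 :> 'rV[k]_(rank F i).
    apply: (f2 _ (e' - e)); [exact: tensor_degreeZ | exact: is_chainB |].
    rewrite linearB /= e'E eE scalerBl -vE // [RHS]linearB [f (_ *: _)]linearZ /=.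
    by rewrite opprB addrC addrA subrK.
  by move/rowP/(_ j)/eqP; rewrite !mxE !eqxx mulr1.
have hjb := shift_betti j.
have [[_ /(_ _ (shift_betti j') jj') jE] hdim] := H i _ hjb.
have [f [f1 f2 _]] := homology_of_tensor hF i (shift j).
have hj := @tensor_degree_delta F i j.
have hj' := @tensor_degree_delta F i j'; rewrite jE in hj'.
have [z [_ zP]] := hdim.
have [a [[e he eE] _]] := zP _ (f1 _ hj).
have [a' [[e' he' e'E] _]] := zP _ (f1 _ hj').
move: eE e'E; rewrite !big_ord1; set c := a 0 _; set c' := a' 0 _ => eE e'E.
(* Modulo boundaries the two generators map to [c] and [c'] times the same class, so this
   combination maps to a boundary. *)
have : c' *: delta_mx 0 j - c *: delta_mx 0 j' = 0 :> 'rV[k]_(rank F i).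
  apply: (f2 _ (c' *: e - c *: e')).
  - by apply/tensor_degreeD/tensor_degreeN; apply: tensor_degreeZ.
  - by apply: is_chainB; apply: is_chainZ.
  have -> : bd (c' *: e - c *: e') = c' *: bd e - c *: bd e'.
    by rewrite linearB; congr (_ - _); exact: linearZ.
  have -> (x y : 'rV[k]_(rank F i)) : f (c' *: x - c *: y) = c' *: f x - c *: f y.
    by rewrite linearB; congr (_ - _); exact: linearZ.
  rewrite eE e'E !scalerBr !scalerA.
  by rewrite opprB [c * c']mulrC addrA subrK.
move=> E; apply/eqP/contraT => njj'.
have c0 : c = 0.
  move/rowP/(_ j'): E; rewrite !mxE !eqxx /= eq_sym (negPf njj') mulr0 mulr1 sub0r.
  by move/eqP; rewrite oppr_eq0 => /eqP.
move: eE; rewrite c0 scale0r subr0 => /(f2 _ _ hj he)/rowP/(_ j)/eqP.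
by rewrite !mxE !eqxx oner_eq0.
Qed.

End Betti.

(** * Based resolutions *)

(** Some term of the Leibniz expansion of the nonzero determinant is nonzero, and its permutation is
    the transversal. *)
Lemma invertible_transversal (k : fieldType) r c (A : 'M[k]_(r, c)) (B : 'M[k]_(c, r)) :
  A *m B = 1%:M -> B *m A = 1%:M ->
  exists2 f : 'I_r -> 'I_c, injective f & forall i, A i (f i) != 0.
Proof.
move=> AB BA; have rc : r = c.
  by apply/eqP; rewrite eqn_leq (mulmx1_min AB) (mulmx1_min BA).
case: _ / rc A B AB BA => A B AB _.
have detA : \det A != 0.
  apply: contra_eq_neq AB => detA; apply/eqP => /(congr1 determinant)/eqP.
  by rewrite det_mulmx detA mul0r det1 eq_sym oner_eq0.
have [/existsP[s /forallP hs]|] :=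
    boolP [exists s : 'S_r, [forall i, A i (s i) != 0]].
  by exists s => //; apply: perm_inj.
move=> /existsPn H; case/eqP: detA; apply: big1 => s _.
have /forallPn [i /negPn/eqP Ai] := H s.
by rewrite (bigD1 i) //= Ai mul0r mulr0.
Qed.

Section Bases.

Variables (n : nat) (L : zmodClosed 'rV[int]_n) (k : fieldType).

Local Notation Q := (Quotient.quot L).
Local Notation R := {mpoly k[n]}.

Lemma red1 r : red (1%:M : 'M[R]_r) = 1%:M.
Proof.
apply/matrixP => i j; rewrite !mxE.
by case: eqP => _; rewrite ?mcoeff1 ?eqxx ?mcoeff0.
Qed.

Lemma red_degree r r' (s : 'I_r -> Q) (s' : 'I_r' -> Q) (M : 'M[R]_(r, r')) i j :
  degree_preserving s s' M -> red M i j != 0 -> s i = s' j.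
Proof.
move=> hM; rewrite mxE -mcoeff_msupp => hij.
by have := hM i j 0%MM; rewrite mxE adeg0 addr0; apply.
Qed.

(** A nonzero constant term in an entry forces its row and column degrees to agree, so a transversal
    of the reduced matrix matches degrees. *)
Lemma degree_preserving_transversal r r' (s : 'I_r -> Q) (s' : 'I_r' -> Q)
    (M : 'M[R]_(r, r')) (N : 'M[R]_(r', r)) :
  degree_preserving s s' M -> red (M *m N) = 1%:M -> red (N *m M) = 1%:M ->
  exists2 f : 'I_r -> 'I_r', injective f &
    forall i, s i = s' (f i) /\ red M i (f i) != 0.
Proof.
move=> hM; rewrite !redM => MN NM.
have [f finj hf] := invertible_transversal MN NM.
by exists f => // i; split=> //; apply: red_degree hM (hf i).
Qed.

Lemma det_red r (M : 'M[R]_r) : \det (red M) = (\det M)@_0%MM.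
Proof. exact: (det_map_mx (mcoeff 0%MM)). Qed.

(** The determinant has constant term 1, so it is nonzero in a domain; multiply by the adjugate. *)
Lemma red1_inj r (M : 'M[R]_r) (v : 'rV[R]_r) :
  red M = 1%:M -> v *m M = 0 -> v = 0.
Proof.
move=> M1 vM; have dM : \det M != 0.
  apply: contra_eq_neq M1 => dM; apply/eqP => /(congr1 determinant)/eqP.
  by rewrite det_red dM mcoeff0 det1 eq_sym oner_eq0.
have : v *m (M *m \adj M) = 0 by rewrite mulmxA vM mul0mx.
rewrite mul_mx_adj mul_mx_scalar => /rowP vd.
apply/rowP => j; apply/eqP; move/eqP: (vd j).
by rewrite !mxE mulf_eq0 (negPf dM).
Qed.

Definition is_basis r (C : 'M[R]_r) : Prop :=
  forall v : 'rV[R]_r, exists! c : 'rV[R]_r, v = c *m C.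

Lemma is_basisP r (C : 'M[R]_r) :
  is_basis C <-> exists2 C' : 'M[R]_r, C *m C' = 1%:M & C' *m C = 1%:M.
Proof.
split=> [hC|[C' CC' C'C] v].
  have /fin_all_exists [c hc] j : exists c : 'rV[R]_r, delta_mx 0 j = c *m C.
    by have [c [cE _]] := hC (delta_mx 0 j); exists c.
  have C'C : (\matrix_j c j) *m C = 1%:M.
    by apply/row_matrixP => j; rewrite row_mul rowK -hc row1.
  by exists (\matrix_j c j) => //; apply: mulmx1C.
exists (v *m C'); split; first by rewrite -mulmxA C'C mulmx1.
by move=> c ->; rewrite -mulmxA CC' mulmx1.
Qed.

(** The homogeneous component of a row of [C'] solves the same equation as the row, and the solution
    is unique. *)
Lemma degree_preserving_inv r (s d : 'I_r -> Q) (C C' : 'M[R]_r) :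
  degree_preserving d s C -> C *m C' = 1%:M -> C' *m C = 1%:M ->
  degree_preserving s d C'.
Proof.
move=> hC CC' C'C j.
suff -> : row j C' = hrow d (s j) (row j C') by apply: hrow_hom.
have H : hrow d (s j) (row j C') *m C = row j C' *m C.
  rewrite -(hrowM _ _ hC) -row_mul C'C row1 hrow_id //.
  exact: homogeneous_delta.
by rewrite -[LHS]mulmx1 -[RHS]mulmx1 -CC' !mulmxA H.
Qed.

Lemma basis_degree (G : based_complex L k) i :
  exists d : 'I_(rank G i) -> Q,
    degree_preserving d (@shift _ _ _ G i) (module_basis G i).
Proof. exact: fin_all_exists (@basis_homogeneous _ _ _ G i). Qed.

Lemma module_basisP (G : based_complex L k) i : is_basis (module_basis G i).
Proof. exact: basis_unique. Qed.

Lemma incomparable_inj r r' (s : 'I_r -> Q) (s' : 'I_r' -> Q) (f : 'I_r -> 'I_r') :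
  injective f -> (forall j, s j = s' (f j)) -> incomparable s' -> incomparable s.
Proof. by move=> finj sf inc j j'; rewrite !sf => /inc/finj. Qed.

Local Notation I := (lattice_ideal L k).

Lemma red_delta r (l : 'I_r) : red (delta_mx 0 l : 'rV[R]_r) = delta_mx 0 l.
Proof.
apply/rowP => j; rewrite !mxE eqxx /=.
by case: eqP => _; rewrite ?mcoeff1 ?eqxx ?mcoeff0.
Qed.

Lemma red_eq1 r (M : 'M[R]_r) :
  (forall l, in_max (delta_mx 0 l *m M - delta_mx 0 l : 'rV[R]_r)) -> red M = 1%:M.
Proof.
move=> hM; apply/row_matrixP => l; have /red_in_max := hM l.
rewrite redB -rowE => /eqP; rewrite subr_eq0 => /eqP E.
have -> : row l (red M) = red (row l M) by apply/rowP => j; rewrite !mxE.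
by rewrite E row1 red_delta.
Qed.

Lemma minimal_comparison (F G : graded_complex L k) :
  minimal_free_resolution I F -> minimal_free_resolution I G ->
  exists (U : forall i, 'M[R]_(rank F i, rank G i))
         (V : forall i, 'M[R]_(rank G i, rank F i)),
    [/\ forall i, degree_preserving (@shift _ _ _ F i) (@shift _ _ _ G i) (U i),
        forall i, degree_preserving (@shift _ _ _ G i) (@shift _ _ _ F i) (V i),
        forall i, diff F i *m U i = U i.+1 *m diff G i
      & U 0%N = const_mx 1] /\
    forall i, red (U i *m V i) = 1%:M /\ red (V i *m U i) = 1%:M.
Proof.
move=> hF hG; have [sF _ _ _] := hF.1; have [sG _ _ _] := hG.1.
have [u uP u0] := row_to_row hF.1 hG.1.
have [v vP v0] := row_to_row hG.1 hF.1.
have uE i x : x *m lin1_mx (u i) = u i x by apply: mul_rV_lin1.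
have vE i x : x *m lin1_mx (v i) = v i x by apply: mul_rV_lin1.
exists (fun i => lin1_mx (u i)), (fun i => lin1_mx (v i)).
have [hu ucomm] := uP; have [hv vcomm] := vP.
split; first split.
- by move=> i l; rewrite rowE uE; apply/hu/homogeneous_delta.
- by move=> i l; rewrite rowE vE; apply/hv/homogeneous_delta.
- move=> i; apply/row_matrixP => l; rewrite !row_mul uE [row l (lin1_mx _)]rowE uE.
  rewrite rowE.
  exact/esym/(ucomm i (shift l))/homogeneous_delta.
- have [j0 hj] := starts_at_R_index sF.
  apply/row_matrixP => l; rewrite rowE uE.
  have -> : delta_mx 0 l = const_mx 1 :> 'rV[R]_(rank F 0).
    by apply/rowP => j; rewrite !mxE (hj l) (hj j) !eqxx.
  by rewrite u0; apply/rowP => j; rewrite !mxE.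
move=> i; split; apply: red_eq1 => l; rewrite mulmxA ?uE ?vE.
  apply: (minimal_endo hF (chain_map_comp uP vP) _ (b := shift l)).
    by move=> b x _ /=; have [p ->] := start_const sF x; rewrite u0 v0.
  exact: homogeneous_delta.
apply: (minimal_endo hG (chain_map_comp vP uP) _ (b := shift l)).
  by move=> b x _ /=; have [p ->] := start_const sG x; rewrite v0 u0.
exact: homogeneous_delta.
Qed.

(** The comparison map itself is the based homomorphism: written in the two bases, its matrix has a
    single nonzero entry in each row, a constant. *)
Lemma incomparable_strongly_indispensable (F : based_complex L k) :
  pointed_lattice L -> minimal_free_resolution I F -> incomparable_shifts F ->
  strongly_indispensable I F.
Proof.
move=> hL hF incF; have [sF _ _ _] := hF.1; split=> // G hG C0.
have [U [V [[hU hV UD U0] UV]]] := minimal_comparison hF hG.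
exists U; split=> //; last first.
  move=> i v vU; apply: (red1_inj (UV i).1).
  by rewrite mulmxA vU mul0mx.
split=> // i l.
have [dB hB] := basis_degree F i; have [dC hC] := basis_degree G i.
set B := module_basis F i in hB *; set C := module_basis G i in hC *.
have [B' BB' B'B] := (is_basisP B).1 (@module_basisP F i).
have [C' CC' C'C] := (is_basisP C).1 (@module_basisP G i).
have hB' := degree_preserving_inv hB BB' B'B.
have hC' := degree_preserving_inv hC CC' C'C.
have [UV1 VU1] := UV i.
(* The degrees of [C] are matched injectively with shifts of [F] and inherit their
   incomparability. *)
have incC : incomparable dC.
  have [|||t tinj /all_and2 [td _]] :=
      @degree_preserving_transversal _ _ dC (@shift _ _ _ F i) (C *m V i) (U i *m C').
  - exact: degree_preservingM hC (hV i).
  - by rewrite mulmxA -(mulmxA C) redM redM VU1 mulmx1 -redM CC' red1.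
  - by rewrite mulmxA -(mulmxA (U i)) C'C mulmx1.
  exact: incomparable_inj tinj td (incF i).
pose M := B *m U i *m C'.
have hM : degree_preserving dB dC M.
  exact: degree_preservingM (degree_preservingM hB (hU i)) hC'.
have [//||t tinj tP] := @degree_preserving_transversal _ _ dB dC M (C *m V i *m B') hM.
- rewrite /M !mulmxA -(mulmxA _ C' C) C'C mulmx1 -(mulmxA B).
  by rewrite redM redM UV1 mulmx1 -redM BB' red1.
- rewrite /M !mulmxA -(mulmxA _ B' B) B'B mulmx1 -(mulmxA C).
  by rewrite redM redM VU1 mulmx1 -redM CC' red1.
have [td tM] := tP l.
(* Such a monomial gives [dC (t l) = dC h + adeg L m]. Incomparability yields [h = t l]; then [m]
   has degree 0, and pointedness makes it 1. *)
have Mlh h m : m \in msupp (M l h) -> h = t l /\ m = 0%MM.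
  move=> mM; have := hM l h m; rewrite mxE => /(_ mM); rewrite td => dE.
  have th : t l = h by apply: incC; apply/geAP; exists m.
  split=> //; apply: (adeg_eq0 hL); move: dE; rewrite th => dE.
  by apply: (addrI (dC h)); rewrite -dE addr0.
exists (t l), (M l (t l))@_0%MM; split; first by rewrite mxE in tM.
have -> : row l B *m U i = row l M *m C by rewrite -!row_mul /M -!mulmxA C'C mulmx1.
rewrite mulmx_sum_row (bigD1 (t l)) //= big1 ?addr0 => [|h ht].
  rewrite mxE; congr (_ *: _); apply/mpolyP => m; rewrite mcoeffC.
  case: eqVneq => [->|m0]; first by rewrite mulr1.
  rewrite mulr0 memN_msupp_eq0 //; apply: contra m0 => /Mlh[_ ->].
  by [].
rewrite mxE (_ : M l h = 0) ?scale0r //; apply/mpolyP => m.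
by rewrite mcoeff0 memN_msupp_eq0 //; apply: contra ht => /Mlh[->].
Qed.

End Bases.

(** * Change of basis by a transvection *)

Section Transvection.

Variables (n : nat) (L : zmodClosed 'rV[int]_n) (k : fieldType).

Local Notation Q := (Quotient.quot L).
Local Notation R := {mpoly k[n]}.

Variables (F : based_complex L k) (i : nat) (l l' : 'I_(rank F i)) (m : 'X_{1..n}).

(* The elementary matrix of position (l, l') in degree i, and 0 in the other
   degrees: comparing natural numbers avoids a cast between ranks. *)
Definition elem_mx j : 'M[R]_(rank F j) :=
  \matrix_(a, b) ([&& j == i, a == l :> nat & b == l' :> nat])%:R.

Definition transvection j : 'M[R]_(rank F j) := 1%:M + 'X_[m] *: elem_mx j.

Lemma elem_mx_neq j : j != i -> elem_mx j = 0.
Proof. by move=> /negPf ji; apply/matrixP => a b; rewrite !mxE ji. Qed.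

Lemma elem_mx_delta : elem_mx i = delta_mx l l'.
Proof. by apply/matrixP => a b; rewrite !mxE eqxx. Qed.

Lemma transvection_neq j : j != i -> transvection j = 1%:M.
Proof. by move=> ji; rewrite /transvection elem_mx_neq // scaler0 addr0. Qed.

Hypothesis ll' : l != l'.

Lemma transvection_inv j :
  exists2 N, transvection j *m N = 1%:M & N *m transvection j = 1%:M.
Proof.
have [->|/transvection_neq ->] := eqVneq j i; last by exists 1%:M; rewrite mulmx1.
suff H : transvection i *m (1%:M - 'X_[m] *: elem_mx i) = 1%:M.
  by exists (1%:M - 'X_[m] *: elem_mx i) => //; apply: mulmx1C.
rewrite mulmxBr mulmx1 mulmxDl mul1mx -scalemxAl -scalemxAr elem_mx_delta.
rewrite mul_delta_mx_0 1?eq_sym // !scaler0 addr0 /transvection elem_mx_delta.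
by rewrite addrK.
Qed.

(** Position 0 is reset to the basis $\{1\}$ that strong indispensability asks of the target. *)
Definition transvected_basis j : 'M[R]_(rank F j) :=
  if j is 0 then const_mx 1 else transvection j *m module_basis F j.

Hypothesis sF : starts_at_R F.

Lemma const_mx1_start : const_mx 1 = 1%:M :> 'M[R]_(rank F 0).
Proof.
have [j0 hj] := starts_at_R_index sF.
by apply/matrixP => a b; rewrite !mxE (hj a) (hj b) eqxx.
Qed.

Lemma transvected_basis_unique j : is_basis (transvected_basis j).
Proof.
case: j => [|j] /=.
  by rewrite const_mx1_start; apply/is_basisP; exists 1%:M; rewrite mulmx1.
have [N TN NT] := transvection_inv j.+1.
have [B' BB' B'B] := (is_basisP _).1 (@module_basisP _ _ _ F j.+1).
apply/is_basisP; exists (B' *m N).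
  by rewrite mulmxA -(mulmxA _ _ B') BB' mulmx1.
by rewrite mulmxA -(mulmxA B') NT mulmx1.
Qed.

Variable d : 'I_(rank F i) -> Q.
Hypothesis hd : degree_preserving d (@shift _ _ _ F i) (module_basis F i).
Hypothesis dll' : d l = d l' + adeg L m.

Lemma transvected_basis_homogeneous j a :
  exists b, homogeneous (@shift _ _ _ F j) b (row a (transvected_basis j)).
Proof.
case: j a => [|j] a /=.
  by exists (shift a); rewrite const_mx1_start row1; apply: homogeneous_delta.
have [ji|ji] := eqVneq j.+1 i; last first.
  by rewrite transvection_neq // mul1mx; apply: basis_homogeneous.
move: a; rewrite ji => a; exists (d a).
rewrite /transvection elem_mx_delta mulmxDl mul1mx linearD /=.
apply: homogeneousD; first exact: hd.
rewrite -scalemxAl linearZ /= rowE mulmxA mul_delta_mx_cond.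
case: eqVneq => [->|_]; last by rewrite mulr0n mul0mx scaler0; apply: homogeneous0.
rewrite mulr1n -rowE dll' -[X in X *: _]scale1r.
exact/homogeneousZ/hd.
Qed.

Definition transvected : based_complex L k :=
  BasedComplex transvected_basis_homogeneous transvected_basis_unique.

End Transvection.

(** * Strong indispensability forces incomparable degrees *)

Section StrongToIncomparable.

Variables (n : nat) (L : zmodClosed 'rV[int]_n) (k : fieldType).

Local Notation Q := (Quotient.quot L).
Local Notation R := {mpoly k[n]}.
Local Notation I := (lattice_ideal L k).

Variable F : based_complex L k.
Hypothesis hF : minimal_free_resolution I F.

Lemma kernel_red i (v : 'rV[R]_(rank F i.+1)) : v *m diff F i = 0 -> red v = 0.
Proof.
have [[_ _ _ exF] _] := hF.
by move=> /exF [w ->]; apply/red_in_max/minimal_diff.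
Qed.

(** The rows of [W] minus the identity are cycles, hence boundaries, and these reduce to zero by
    minimality. *)
Lemma endo_red1 i (W : 'M[R]_(rank F i.+1)) :
  diff F i = W *m diff F i -> red W = 1%:M.
Proof.
move=> hW; apply: red_eq1 => l; apply/red_in_max/kernel_red.
by rewrite mulmxBl -mulmxA -hW subrr.
Qed.

Lemma row_delta_mul r (B : 'M[R]_r) (x l l' : 'I_r) :
  row x (delta_mx l l' *m B) = (x == l)%:R *: row l' B.
Proof.
rewrite row_mul (_ : row x _ = (x == l)%:R *: delta_mx 0 l').
  by rewrite -scalemxAl -rowE.
by apply/rowP => y; rewrite !mxE eqxx /= -natrM mulnb.
Qed.

Lemma row_proportional r (A N : 'M[k]_r) a b c : A *m N = 1%:M ->
  row a A = c *: row b A -> delta_mx 0 a = c *: delta_mx 0 b :> 'rV[k]_r.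
Proof.
move=> AN /(congr1 (mulmx^~ N)).
by rewrite -scalemxAl -!row_mul AN !row1.
Qed.

Lemma delta_proportional r (a b : 'I_r) (c : k) :
  delta_mx 0 a = c *: delta_mx 0 b :> 'rV[k]_r -> a = b /\ c = 1.
Proof.
move=> /rowP/(_ a); rewrite !mxE !eqxx /=.
case: eqVneq => [->|_]; first by rewrite mulr1.
by rewrite mulr0 => /eqP; rewrite oner_eq0.
Qed.

Lemma delta_proportional_transvected r (a a' b : 'I_r) (c x y : k) : a != a' ->
  delta_mx 0 a = c *: (delta_mx 0 b + x *: (y *: delta_mx 0 a'))
    :> 'rV[k]_r -> a = b /\ c = 1.
Proof.
move=> /negPf aa' /rowP/(_ a); rewrite !mxE !eqxx aa' /= !mulr0 addr0.
case: eqVneq => [->|_]; first by rewrite mulr1.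
by rewrite mulr0 => /eqP; rewrite oner_eq0.
Qed.

Lemma strongly_indispensable_basis_incomparable i (d : 'I_(rank F i) -> Q) :
  strongly_indispensable I F ->
  degree_preserving d (@shift _ _ _ F i) (module_basis F i) -> incomparable d.
Proof.
move=> [sF strong] hd l l' /geAP [m dll']; apply/eqP/contraT => ll'.
case: i d hd l l' dll' ll' => [|i] d hd l l' dll' ll'.
  have [j0 hj] := starts_at_R_index sF.
  by rewrite (hj l) (hj l') eqxx in ll'.
pose G := transvected ll' sF hd dll'.
have [W [[hW WD Wb] _ W0]] := strong G hF erefl.
have bB j := (is_basisP _).1 (@module_basisP _ _ _ F j).
have redZ r c (v : 'rV[R]_r) : red (c%:MP *: v) = c *: red v.
  by apply/rowP => x; rewrite !mxE mcoeffCM.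
have redrow r (M : 'M[R]_r) x : row x (red M) = red (row x M).
  by apply/rowP => y; rewrite !mxE.
(* Below the modified position both bases agree. [W] is the identity modulo the variables there, so
   each basis element can only go to itself, with scalar 1. *)
have W1 j : (j <= i)%N -> W j = 1%:M.
  elim: j => [_|j IH ji]; first by rewrite W0; apply: const_mx1_start.
  have red1W : red (W j.+1) = 1%:M.
    by apply: endo_red1; rewrite -(WD j) IH ?mulmx1 // ltnW.
  have [B' BB' B'B] := bB j.+1.
  suff WB : module_basis F j.+1 *m W j.+1 = module_basis F j.+1.
    by rewrite -[W _]mul1mx -B'B -mulmxA WB.
  apply/row_matrixP => a; rewrite row_mul.
  have [b [c [c0 E]]] := Wb j.+1 a.
  have Gj : module_basis G j.+1 = module_basis F j.+1.
    by rewrite /= transvection_neq ?mul1mx // neq_ltn ltnS ji.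
  rewrite Gj in E; rewrite E.
  have [-> ->] : a = b /\ c = 1; last by rewrite mpolyC1 scale1r.
  apply/delta_proportional/(@row_proportional _ (red (module_basis F j.+1)) (red B')).
    by rewrite -redM BB' red1.
  by rewrite !redrow -redZ -E redM red1W mulmx1.
have red1W : red (W i.+1) = 1%:M.
  by apply: endo_red1; rewrite -(WD i) W1 ?mulmx1.
have [B' BB' B'B] := bB i.+1.
set B := module_basis F i.+1 in bB BB' B'B.
have [b [c [c0 E]]] := Wb i.+1 l.
have GE : module_basis G i.+1 = (1%:M + 'X_[m] *: delta_mx l l') *m B.
  by rewrite /= /transvection elem_mx_delta.
rewrite GE -/B in E.
have rowG x : row x ((1%:M + 'X_[m] *: delta_mx l l') *m B) =
    row x B + (x == l)%:R *: ('X_[m] *: row l' B).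
  rewrite mulmxDl mul1mx -scalemxAl linearD linearZ /= row_delta_mul.
  by rewrite !scalerA mulrC.
have [bl cE] : l = b /\ c = 1.
  have redZp p (v : 'rV[R]_(rank F i.+1)) : red (p *: v) = p@_0%MM *: red v.
    by apply/rowP => x; rewrite !mxE mcoeff0M.
  have rowB x : red (row x B) *m red B' = delta_mx 0 x.
    by rewrite -redM -row_mul BB' row1 red_delta.
  have := congr1 (fun v => red v *m red B') E.
  rewrite redM red1W mulmx1 rowB redZ rowG redD !redZp -scalemxAl mulmxDl.
  by rewrite -!scalemxAl !rowB; apply: delta_proportional_transvected.
rewrite -bl cE rowG eqxx mpolyC1 !scale1r in E.
(* [W] adds $x^m$ times row [l'] to row [l] but preserves its differential, as [W] is the identity
   one step below. *)
have XB0 : 'X_[m] *: (row l' B *m diff F i) = 0.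
  have := congr1 (mulmx^~ (diff F i)) E.
  rewrite -mulmxA -(WD i) (W1 i (leqnn i)) mulmx1 mulmxDl -scalemxAl => /eqP.
  by rewrite -[X in X == _]addr0 (inj_eq (addrI _)) eq_sym => /eqP.
have B0 : row l' B *m diff F i = 0.
  apply/rowP => x; apply/eqP; move/rowP/(_ x)/eqP: XB0; rewrite !mxE.
  rewrite mulf_eq0 => /orP[/eqP/(congr1 (mcoeff m))|//].
  by rewrite mcoeffX eqxx mcoeff0 => /eqP; rewrite oner_eq0.
(* A basis element that is a cycle would reduce to zero, which the invertibility of [red B]
   forbids. *)
have := kernel_red B0; rewrite -redrow => /(congr1 (mulmx^~ (red B'))).
rewrite -row_mul -redM BB' red1 row1 mul0mx => /rowP/(_ l')/eqP.
by rewrite !mxE !eqxx oner_eq0.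
Qed.

(** The degrees of the chosen basis and the shifts are matched by a transversal of the change of
    basis, which carries incomparability over to the shifts. *)
Lemma strongly_indispensable_incomparable :
  strongly_indispensable I F -> incomparable_shifts F.
Proof.
move=> strong i; have [d hd] := basis_degree F i.
have [B' BB' B'B] := (is_basisP _).1 (@module_basisP _ _ _ F i).
have hB' := degree_preserving_inv hd BB' B'B.
have [||t tinj /all_and2 [td _]] :=
  degree_preserving_transversal hB' (N := module_basis F i).
- by rewrite B'B red1.
- by rewrite BB' red1.
exact: incomparable_inj tinj td (strongly_indispensable_basis_incomparable strong hd).
Qed.

End StrongToIncomparable.

Theorem theorem4p7 (k : fieldType) (n : nat) (L : zmodClosed 'rV[int]_n)
    (hL : pointed_lattice L) (F : based_complex L k)
    (hF : minimal_free_resolution (lattice_ideal L k) F) :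
  strongly_indispensable (lattice_ideal L k) F <->
  (forall (i : nat) (b : Quotient.quot L),
     betti_degree (lattice_ideal L k) i b ->
     minimal_betti_degree (lattice_ideal L k) i b /\
     reduced_homology_dim k (gcd_complex b) i 1).
Proof.
rewrite -(incomparable_shiftsP hF); split.
  exact: strongly_indispensable_incomparable.
exact: incomparable_strongly_indispensable.
Qed.
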